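(* Let $I$ and $J$ be $k$-subsets of $\{1,\dots,n\}$, let $U=\{u\notin I: u+1\in I\}$ and $V=\{v\in I: v+1\notin I\}$, and let $a$ be the non-negative integer such that $\mathrm{Ext}^{2}_B(L_I,L_J)\cong\mathbb F[t]/(t^a)$ as $\mathbb F[t]$-modules. Then $$a=\min_{u\in U,\,v\in V} a_{uv},$$ where $$a_{uv}=\begin{cases}\#\big(J\cap(u-(n-k),v]\big)+\#\big(I\cap(v,u]\big), & \text{if } u \text{ is to the right of } v,\\[2pt] \#\big((u,v]\setminus I\big)+\#\big((v,u+k]\setminus J\big), & \text{if } u\text{ is to the left of } v.\end{cases}$$
   Context: Let $\mathbb F$ be an algebraically closed field, and let $n\ge 2$ and $1\le k\le n-1$ be integers. Elements of $\{1,\dots,n\}$ are read modulo $n$; $(a,b]$ denotes the cyclic interval $\{a+1,\dots,b\}$ modulo $n$, empty if $a\equiv b$. Let $B$ be the quotient of the path algebra over $\mathbb F$ of the quiver with vertex set $\mathbb Z_n$ and arrows $x_i:i-1\to i$, $y_i:i\to i-1$ ($i\in\mathbb Z_n$) by the relations $xy=yx$ and $x^k=y^{n-k}$, one of each kind starting at every vertex (that is, $x_iy_i=y_{i+1}x_{i+1}$ at vertex $i$, paths composed as functions, and the length-$k$ path of $x$'s from $i$ to $i+k$ equals the length-$(n-k)$ path of $y$'s from $i$ to $i+k$). Its centre is $\mathbb F[t]$, $t=\sum_i x_iy_i$. Modules are left modules, i.e. representations of the quiver. For a $k$-subset $I\subseteq\{1,\dots,n\}$, the rank $1$ module $L_I$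 has a copy $U_i=\mathbb F[t]$ at each vertex $i$; $x_i:U_{i-1}\to U_i$ is multiplication by $1$ if $i\in I$ and by $t$ if $i\notin I$; $y_i:U_i\to U_{i-1}$ is multiplication by $t$ if $i\in I$ and by $1$ if $i\notin I$. For $u\in U$ and $v\in V$, $u$ is said to be to the left of $v$ if the cyclic interval $(u,v]$ has at most $k$ elements; otherwise $u$ is to the right of $v$. For all rank $1$ modules $L_I,L_J$, the module $\mathrm{Ext}^2_B(L_I,L_J)$ is isomorphic to $\mathbb F[t]/(t^a)$ for some integer $a\geq 0$. *)

(* Defs.v *)
From HB Require Import structures.
From mathcomp Require Import all_boot all_order all_algebra.
From mathcomp Require Import boolp.

Set Implicit Arguments.
Unset Strict Implicit.
Unset Printing Implicit Defensive.

Import GRing.Theory.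
Local Open Scope ring_scope.
Local Open Scope quotient_scope.

Section QuotientModule.
Variables (R : pzRingType) (V : lmodType R) (S : submodClosed V).

(* The type submodClosed is stated for semirings and does not itself provide
   the closure under opposites that Quotient.quot requires. *)
Definition submod_pred : {pred V} := S.
Fact submod_pred_closed : submod_closed submod_pred.
Proof. exact: submodClosedP. Qed.
HB.instance Definition _ :=
  GRing.isSubmodClosed.Build R V submod_pred submod_pred_closed.

Definition quot_lmod : Type := Quotient.quot submod_pred.
HB.instance Definition _ := GRing.Zmodule.on quot_lmod.

Definition quot_pi (v : V) : quot_lmod := \pi_(Quotient.quot submod_pred) v.

Definition quot_scale (a : R) (u : quot_lmod) : quot_lmod :=
  quot_pi (a *: repr (u : Quotient.quot submod_pred)).

Lemma quot_pi_surj u : exists v, u = quot_pi v.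
Proof.
exists (repr (u : Quotient.quot submod_pred)); symmetry.
exact: (@reprK _ (Quotient.quot submod_pred)).
Qed.

Lemma quot_pi_eq u v : (quot_pi u == quot_pi v) = (u - v \in submod_pred).
Proof. by rewrite (Quotient.idealrBE submod_pred). Qed.

Lemma quot_piD u v : quot_pi (u + v) = quot_pi u + quot_pi v.
Proof. exact: (raddfD (\pi_(Quotient.quot submod_pred))). Qed.

Lemma quot_scale_pi a v : quot_scale a (quot_pi v) = quot_pi (a *: v).
Proof.
apply/eqP; rewrite quot_pi_eq -scalerBr rpredZ //.
rewrite -quot_pi_eq; apply/eqP; exact: (@reprK _ (Quotient.quot submod_pred)).
Qed.

Fact quot_scaleA a b v : quot_scale a (quot_scale b v) = quot_scale (a * b) v.
Proof. by have [w ->] := quot_pi_surj v; rewrite !quot_scale_pi scalerA. Qed.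
Fact quot_scale1 : left_id 1 quot_scale.
Proof.
by move=> v; have [w ->] := quot_pi_surj v; rewrite quot_scale_pi scale1r.
Qed.
Fact quot_scaleDr : right_distributive quot_scale +%R.
Proof.
move=> a u v; have [u' ->] := quot_pi_surj u; have [v' ->] := quot_pi_surj v.
by rewrite -quot_piD !quot_scale_pi -quot_piD scalerDr.
Qed.
Fact quot_scaleDl v : {morph quot_scale^~ v : a b / a + b}.
Proof.
move=> a b; have [w ->] := quot_pi_surj v.
by rewrite !quot_scale_pi -quot_piD scalerDl.
Qed.
HB.instance Definition _ := GRing.Zmodule_isLmodule.Build R quot_lmod
  quot_scaleA quot_scale1 quot_scaleDr quot_scaleDl.

End QuotientModule.

Definition lmod_isomorphic (R : pzRingType) (A B : lmodType R) : Prop :=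
  exists f : {linear A -> B}, bijective f.

Section TruncatedPolynomials.
Variables (F : fieldType) (a : nat).

Definition Xn_ideal : {pred ({poly F})^o} := fun p => 'X^a %| (p : {poly F}).

Fact Xn_ideal_submod : submod_closed Xn_ideal.
Proof.
split; first exact: dvdp0.
by move=> p u v ? ?; apply: dvdp_add => //; apply: dvdp_mull.
Qed.
HB.instance Definition _ :=
  GRing.isSubmodClosed.Build {poly F} ({poly F})^o Xn_ideal Xn_ideal_submod.

(* F[t]/(t^a) as an F[t]-module.  The ring {poly %/ 'X^a} of qpoly is not used
   because it is not the zero ring for a = 0. *)
Definition truncated_poly : lmodType {poly F} := quot_lmod Xn_ideal.

End TruncatedPolynomials.

Section PolynomialAction.
Variables (F : fieldType) (V : lmodType F) (T : {linear V -> V}).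
Implicit Types (p q : {poly F}) (u v : V).

Definition poly_act (p : {poly F}) (v : V) : V :=
  \sum_(j < size p) p`_j *: iter j T v.

Lemma poly_act_widen m p v : (size p <= m)%N ->
  poly_act p v = \sum_(j < m) p`_j *: iter j T v.
Proof.
move=> le_pm; rewrite /poly_act (big_ord_widen m (fun j => p`_j *: iter j T v)) //.
rewrite big_mkcond; apply: eq_bigr => j _.
by case: ltnP => // /(nth_default 0) ->; rewrite scale0r.
Qed.

Lemma poly_actDl p q v : poly_act (p + q) v = poly_act p v + poly_act q v.
Proof.
rewrite (@poly_act_widen (maxn (size p) (size q)) (p + q)) ?size_polyD //.
rewrite (@poly_act_widen (maxn (size p) (size q)) p) ?leq_maxl //.
rewrite (@poly_act_widen (maxn (size p) (size q)) q) ?leq_maxr //.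
by rewrite -big_split; apply: eq_bigr => j _; rewrite coefD scalerDl.
Qed.

Lemma iter_linear j a u v :
  iter j T (a *: u + v) = a *: iter j T u + iter j T v.
Proof. by elim: j => //= j ->; rewrite linearP. Qed.

Lemma poly_act_linear p : linear (poly_act p).
Proof.
move=> a u v; rewrite /poly_act scaler_sumr -big_split; apply: eq_bigr => j _.
by rewrite iter_linear scalerDr !scalerA [a * _]mulrC.
Qed.

Lemma poly_actC c v : poly_act c%:P v = c *: v.
Proof.
by rewrite (@poly_act_widen 1) ?size_polyC_leq1 // big_ord1 coefC.
Qed.

Lemma poly_actMX p v : poly_act (p * 'X) v = poly_act p (T v).
Proof.
rewrite (@poly_act_widen (size p).+1) ?(leq_trans (size_polyMleq _ _)) //.
  rewrite big_ord_recl coefMX scale0r add0r; apply: eq_bigr => j _.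
  by rewrite coefMX -iterSr.
by rewrite size_polyX addn2.
Qed.

Lemma poly_act_comm p v : poly_act p (T v) = T (poly_act p v).
Proof.
rewrite /poly_act linear_sum; apply: eq_bigr => j _.
by rewrite linearZ -iterSr.
Qed.

Lemma poly_actM p q v : poly_act (p * q) v = poly_act p (poly_act q v).
Proof.
elim/poly_ind: p q v => [|p c IH] q v.
  by rewrite mul0r -[0]polyC0 !poly_actC !scale0r.
have XM w : poly_act ('X * q) w = T (poly_act q w).
  by rewrite mulrC poly_actMX poly_act_comm.
rewrite mulrDl -mulrA !poly_actDl poly_actC poly_actMX IH XM.
congr (_ + _); elim/poly_ind: q v {XM} => [|q d IHq] v.
  by rewrite mulr0 -[0]polyC0 !poly_actC !scale0r scaler0.
by rewrite mulrDr mulrA !poly_actDl !poly_actMX IHq -polyCM !poly_actC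
           scalerDr scalerA.
Qed.

End PolynomialAction.

Section Representations.
Variables (F : fieldType) (n : nat).

Record quiver_rep := QuiverRep {
  space :> 'Z_n -> lmodType F;
  xmap : forall i, {linear space (i - 1) -> space i};
  ymap : forall i, {linear space i -> space (i - 1)}
}.

(* The vertex i - m, reached by subtracting 1 repeatedly so that the composites
   below need no transport between equal vertices. *)
Definition back (m : nat) (i : 'Z_n) : 'Z_n := iter m (fun j => j - 1) i.

Lemma backE m (i : 'Z_n) : back m i = i - m%:R.
Proof.
by elim: m => [|m IH]; rewrite ?subr0 //= IH -natr1 opprD addrA.
Qed.

Fixpoint xpath (M : quiver_rep) m i : M (back m i) -> M i :=
  match m with
  | 0 => id
  | m'.+1 => fun v => xpath (xmap M (back m' i) v)
  end.

Fixpoint ypath (M : quiver_rep) m i : M i -> M (back m i) :=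
  match m with
  | 0 => id
  | m'.+1 => fun v => ymap M (back m' i) (ypath m' v)
  end.

End Representations.

Arguments xpath {F n} M m i.
Arguments ypath {F n} M m i.

(* In bmod_xy the relation xy = yx is written at the vertex i - 1.  In
   bmod_xk_yk the relation x^k = y^(n-k) is written at the vertex i - k; the
   two sides live at the vertices i and i - k - (n - k), which are equal in
   Z/n but not convertible, so they are compared in the total space. *)
Record bmod (F : fieldType) (n k : nat) := BMod {
  bmod_rep :> quiver_rep F n;
  bmod_xy : forall (i : 'Z_n) (v : bmod_rep (i - 1)),
    xmap bmod_rep (i - 1) (ymap bmod_rep (i - 1) v) =
    ymap bmod_rep i (xmap bmod_rep i v);
  bmod_xk_yk : forall (i : 'Z_n) (v : bmod_rep (back k i)),
    Tagged (space bmod_rep) (xpath bmod_rep k i v) =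
    Tagged (space bmod_rep) (ypath bmod_rep (n - k) (back k i) v)
}.

Section Morphisms.
Variables (F : fieldType) (n k : nat).
Implicit Types M N K : bmod F n k.

Record bhom M N := BHom {
  bhom_fun :> forall i, M i -> N i;
  bhom_linear : forall i, linear (@bhom_fun i);
  bhom_x : forall i v,
    @bhom_fun i (xmap M i v) = xmap N i (@bhom_fun (i - 1) v);
  bhom_y : forall i v,
    @bhom_fun (i - 1) (ymap M i v) = ymap N i (@bhom_fun i v)
}.
Arguments bhom_fun {M N} b i v.

Lemma bhomP M N (f g : bhom M N) : (forall i v, f i v = g i v) -> f = g.
Proof.
case: f g => [f fl fx fy] [g gl gx gy] /= fg.
have E : f = g by apply: functional_extensionality_dep => i; apply/funext/fg.
case: _ / E gl gx gy {fg} => gl gx gy.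
by congr BHom; apply: Prop_irrelevance.
Qed.

Definition bhom_comp M N K (g : bhom N K) (f : bhom M N) : bhom M K.
Proof.
exists (fun i v => g i (f i v)).
- by move=> i a u v; rewrite !bhom_linear.
- by move=> i v; rewrite !bhom_x.
- by move=> i v; rewrite !bhom_y.
Defined.

(* The central element t, acting on M i as x_i y_i. *)
Definition t_act M i : {linear M i -> M i} := xmap M i \o ymap M i.

Definition bmod_act M (p : {poly F}) i : M i -> M i := poly_act (t_act M i) p.
Arguments bmod_act : clear implicits.

Lemma iter_t_x M i j v :
  iter j (t_act M i) (xmap M i v) = xmap M i (iter j (t_act M (i - 1)) v).
Proof. by elim: j => //= j ->; rewrite bmod_xy. Qed.

Lemma iter_t_y M i j v :
  iter j (t_act M (i - 1)) (ymap M i v) = ymap M i (iter j (t_act M i) v).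
Proof. by elim: j => //= j ->; rewrite bmod_xy. Qed.

Lemma bmod_act_x M p i v :
  bmod_act M p i (xmap M i v) = xmap M i (bmod_act M p (i - 1) v).
Proof.
rewrite /bmod_act /poly_act linear_sum; apply: eq_bigr => j _.
by rewrite linearZ iter_t_x.
Qed.

Lemma bmod_act_y M p i v :
  bmod_act M p (i - 1) (ymap M i v) = ymap M i (bmod_act M p i v).
Proof.
rewrite /bmod_act /poly_act linear_sum; apply: eq_bigr => j _.
by rewrite linearZ iter_t_y.
Qed.

Lemma bhom_t M N (f : bhom M N) i v : f i (t_act M i v) = t_act N i (f i v).
Proof. by rewrite /= bhom_x bhom_y. Qed.

Lemma bhom0 M N (f : bhom M N) i : f i 0 = 0.
Proof. by have := bhom_linear f (i := i) (-1) 0 0; rewrite !scaleN1r !addNr. Qed.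

Definition bhom_zero M N : bhom M N.
Proof.
exists (fun i _ => 0) => [i a u v|i v|i v]; rewrite ?linear0 //.
by rewrite addr0.
Defined.

Definition bhom_opp M N (f : bhom M N) : bhom M N.
Proof.
exists (fun i v => - f i v) => [i a u v|i v|i v].
- by rewrite bhom_linear opprD scalerN.
- by rewrite bhom_x linearN.
- by rewrite bhom_y linearN.
Defined.

Definition bhom_add M N (f g : bhom M N) : bhom M N.
Proof.
exists (fun i v => f i v + g i v) => [i a u v|i v|i v].
- by rewrite !bhom_linear scalerDr addrACA.
- by rewrite !bhom_x linearD.
- by rewrite !bhom_y linearD.
Defined.

Definition bhom_scale M N (p : {poly F}) (f : bhom M N) : bhom M N.
Proof.
exists (fun i v => bmod_act N p i (f i v)) => [i a u v|i v|i v].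
- by rewrite bhom_linear /bmod_act poly_act_linear.
- by rewrite bhom_x bmod_act_x.
- by rewrite bhom_y bmod_act_y.
Defined.

HB.instance Definition _ M N := gen_eqMixin (bhom M N).
HB.instance Definition _ M N := gen_choiceMixin (bhom M N).

Fact bhom_addA M N : associative (@bhom_add M N).
Proof. by move=> f g h; apply: bhomP => i v /=; rewrite addrA. Qed.
Fact bhom_addC M N : commutative (@bhom_add M N).
Proof. by move=> f g; apply: bhomP => i v /=; rewrite addrC. Qed.
Fact bhom_add0 M N : left_id (bhom_zero M N) (@bhom_add M N).
Proof. by move=> f; apply: bhomP => i v /=; rewrite add0r. Qed.
Fact bhom_addN M N : left_inverse (bhom_zero M N) (@bhom_opp M N) (@bhom_add M N).
Proof. by move=> f; apply: bhomP => i v /=; rewrite addNr. Qed.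
HB.instance Definition _ M N := GRing.isZmodule.Build (bhom M N)
  (@bhom_addA M N) (@bhom_addC M N) (@bhom_add0 M N) (@bhom_addN M N).

Fact bhom_scaleA M N p q (f : bhom M N) :
  bhom_scale p (bhom_scale q f) = bhom_scale (p * q) f.
Proof. by apply: bhomP => i v; rewrite /= /bmod_act poly_actM. Qed.
Fact bhom_scale1 M N : left_id 1 (@bhom_scale M N).
Proof.
by move=> f; apply: bhomP => i v; rewrite /= /bmod_act poly_actC scale1r.
Qed.
Fact bhom_scaleDr M N : right_distributive (@bhom_scale M N) +%R.
Proof.
move=> p f g; apply: bhomP => i v /=; rewrite /bmod_act.
by have := poly_act_linear (t_act N i) p 1 (f i v) (g i v); rewrite !scale1r.
Qed.
Fact bhom_scaleDl M N (f : bhom M N) : {morph (@bhom_scale M N)^~ f : p q / p + q}.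
Proof. by move=> p q; apply: bhomP => i v; rewrite /= /bmod_act poly_actDl. Qed.
HB.instance Definition _ M N := GRing.Zmodule_isLmodule.Build {poly F} (bhom M N)
  (@bhom_scaleA M N) (@bhom_scale1 M N) (@bhom_scaleDr M N) (@bhom_scaleDl M N).

Definition surjective M N (f : bhom M N) : Prop :=
  forall i (w : N i), exists v : M i, f i v = w.

Definition exact_at M N K (f : bhom M N) (g : bhom N K) : Prop :=
  forall i (w : N i), g i w = 0 <-> exists v : M i, f i v = w.

Definition projective (P : bmod F n k) : Prop :=
  forall (M N : bmod F n k) (g : bhom M N) (f : bhom P N),
    surjective g -> exists h : bhom P M, bhom_comp g h = f.

Record projective_resolution (M : bmod F n k) := ProjectiveResolution {
  res_obj :> nat -> bmod F n k;
  res_d : forall m, bhom (res_obj m.+1) (res_obj m);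
  res_aug : bhom (res_obj 0) M;
  res_projective : forall m, projective (res_obj m);
  res_aug_surj : surjective res_aug;
  res_exact0 : exact_at (res_d 0) res_aug;
  res_exact : forall m, exact_at (res_d m.+1) (res_d m)
}.

End Morphisms.

Section Ext.
Variables (F : fieldType) (n k : nat) (M : bmod F n k).
Variables (P : projective_resolution M) (N : bmod F n k).

Definition is_coboundary m : bhom (P m) N -> Prop :=
  match m with
  | 0 => fun f => f = 0
  | m'.+1 => fun f => exists g : bhom (P m') N, f = bhom_comp g (res_d P m')
  end.

Lemma is_coboundary0 m : is_coboundary (0 : bhom (P m) N).
Proof. by case: m => [|m] //=; exists 0; apply: bhomP. Qed.

Lemma is_coboundary_lin m p (f g : bhom (P m) N) :
  is_coboundary f -> is_coboundary g -> is_coboundary (p *: f + g).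
Proof.
case: m f g => [|m] f g /=; first by move=> -> ->; rewrite scaler0 addr0.
by move=> [f' ->] [g' ->]; exists (p *: f' + g'); apply: bhomP.
Qed.

Variable m : nat.

Definition cocycle : {pred bhom (P m) N} :=
  fun f => bhom_comp f (res_d P m) == 0.

Fact cocycle_submod : submod_closed cocycle.
Proof.
split=> [|p f g]; first by apply/eqP/bhomP.
move=> /eqP f0 /eqP g0; apply/eqP/bhomP => i v /=.
move/(congr1 (fun h : bhom _ _ => h i v)): f0 => /= ->.
move/(congr1 (fun h : bhom _ _ => h i v)): g0 => /= ->.
rewrite addr0 /bmod_act.
have := poly_act_linear (t_act N i) p (-1) 0 0.
by rewrite !scaleN1r !addNr.
Qed.
HB.instance Definition _ :=
  GRing.isSubmodClosed.Build {poly F} (bhom (P m) N) cocycle cocycle_submod.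

Record cocycles := Cocycle { cocycle_val :> bhom (P m) N; _ : cocycle_val \in cocycle }.
HB.instance Definition _ := [isSub for cocycle_val].
HB.instance Definition _ := [Choice of cocycles by <:].
HB.instance Definition _ := [SubChoice_isSubLmodule of cocycles by <:].

Definition coboundary : {pred cocycles} := fun f => `[< is_coboundary (val f) >].

Fact coboundary_submod : submod_closed coboundary.
Proof.
split=> [|p f g]; first by apply/asboolP; rewrite linear0; apply: is_coboundary0.
move=> /asboolP fB /asboolP gB; apply/asboolP.
by rewrite linearP; apply: is_coboundary_lin.
Qed.
HB.instance Definition _ :=
  GRing.isSubmodClosed.Build {poly F} cocycles coboundary coboundary_submod.

(* Ext^m(M, N) computed from the resolution P, as the m-th cohomology of
   Hom(P, N). *)
Definition Ext : lmodType {poly F} := quot_lmod coboundary.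

End Ext.

Section RankOne.
Variables (F : fieldType) (n k : nat) (I : {set 'Z_n}).

Definition rank1_x (i : 'Z_n) (p : {poly F}) : {poly F} :=
  (if i \in I then 1 else 'X) * p.
Definition rank1_y (i : 'Z_n) (p : {poly F}) : {poly F} :=
  (if i \in I then 'X else 1) * p.

Fact rank1_x_linear i : linear (rank1_x i).
Proof. by move=> a p q; rewrite /rank1_x mulrDr scalerAr. Qed.
Fact rank1_y_linear i : linear (rank1_y i).
Proof. by move=> a p q; rewrite /rank1_y mulrDr scalerAr. Qed.
HB.instance Definition _ i := GRing.isLinear.Build F {poly F} {poly F} *:%R
  (rank1_x i) (rank1_x_linear i).
HB.instance Definition _ i := GRing.isLinear.Build F {poly F} {poly F} *:%R
  (rank1_y i) (rank1_y_linear i).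

Definition rank1_rep : quiver_rep F n :=
  @QuiverRep F n (fun _ => {poly F}) rank1_x rank1_y.

Lemma rank1_xpath m i p : xpath rank1_rep m i p =
  'X^(\sum_(j < m) (back j i \notin I)) * p.
Proof.
elim: m p => [|m IH] p /=; first by rewrite big_ord0 mul1r.
rewrite IH big_ord_recr /= /rank1_x exprD -mulrA.
by case: (_ \in I); rewrite ?expr0 ?expr1.
Qed.

Lemma rank1_ypath m i p : ypath rank1_rep m i p =
  'X^(\sum_(j < m) (back j i \in I)) * p.
Proof.
elim: m => [|m IH] /=; first by rewrite big_ord0 mul1r.
rewrite IH big_ord_recr /= /rank1_y mulrA; congr (_ * _).
by rewrite addnC exprD; case: (_ \in I); rewrite ?expr0 ?expr1.
Qed.

Hypotheses (n_gt1 : (1 < n)%N) (cardI : #|I| = k).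

Lemma sum_back (i : 'Z_n) : (\sum_(j < n) (back j i \in I) = k)%N.
Proof.
case: n I n_gt1 cardI i => [|[|m]] // J _ <- i; rewrite -sum1_card.
rewrite [RHS]big_mkcond /= [RHS](reindex_inj (h := fun j => i - j)) /=; last first.
  by move=> j1 j2 /addrI/oppr_inj.
by apply: eq_bigr => j _; rewrite backE (natr_Zp j); case: (_ \in J).
Qed.

Lemma k_le_n : (k <= n)%N.
Proof.
case: n I n_gt1 cardI => [|[|m]] // J _ <-.
by rewrite (leq_trans (max_card _)) // card_ord.
Qed.

Fact rank1_xy (i : 'Z_n) (v : rank1_rep (i - 1)) :
  xmap rank1_rep (i - 1) (ymap rank1_rep (i - 1) v) =
  ymap rank1_rep i (xmap rank1_rep i v).
Proof.
rewrite /= /rank1_x /rank1_y.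
by case: (_ \in I); case: (_ \in I); rewrite ?mul1r.
Qed.

Fact rank1_xk_yk (i : 'Z_n) (v : rank1_rep (back k i)) :
  Tagged (space rank1_rep) (xpath rank1_rep k i v) =
  Tagged (space rank1_rep) (ypath rank1_rep (n - k) (back k i) v).
Proof.
rewrite rank1_xpath rank1_ypath.
have backD a b : back a (back b i) = back (b + a) i.
  by rewrite !backE natrD opprD addrA.
have -> : back (n - k) (back k i) = i.
  by rewrite backD subnKC ?k_le_n // backE pchar_Zp // subr0.
suff -> : (\sum_(j < k) (back j i \notin I) =
  \sum_(j < n - k) (back j (back k i) \in I))%N by [].
have := big_split_ord addn xpredT (fun j : 'I_(k + (n - k)) => back j i \in I : nat).
rewrite /= subnKC ?k_le_n // sum_back.
move=> E; apply/eqP; rewrite -(eqn_add2l (\sum_(j < k) (back j i \in I))).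
rewrite -big_split /= (eq_bigr (fun _ => 1%N)); last by move=> j _; case: (_ \in I).
rewrite sum_nat_const card_ord muln1 {1}E; apply/eqP; congr (_ + _)%N.
by apply: eq_bigr => j _; rewrite backD.
Qed.

Definition rank1 : bmod F n k := BMod rank1_xy rank1_xk_yk.

End RankOne.

Section Combinatorics.
Variables (n k : nat).
Implicit Types (u v : 'Z_n) (I J : {set 'Z_n}).

(* The cyclic interval (a, b], empty if a = b. *)
Definition cint (a b : 'Z_n) : {set 'Z_n} :=
  [set j | (0 < val (j - a)%R <= val (b - a)%R)%N].

Definition left_of u v : bool := (#|cint u v| <= k)%N.

Definition starts I : {set 'Z_n} := [set u | (u \notin I) && (u + 1 \in I)].
Definition ends I : {set 'Z_n} := [set v | (v \in I) && (v + 1 \notin I)].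

Definition auv I J u v : nat :=
  if left_of u v then (#|cint u v :\: I| + #|cint v (u + k%:R)%R :\: J|)%N
  else (#|J :&: cint (u - (n - k)%:R)%R v| + #|I :&: cint v u|)%N.

End Combinatorics.

Definition is_min2 (S T : finType) (A : {set S}) (B : {set T})
    (f : S -> T -> nat) (a : nat) : Prop :=
  (exists u v, [/\ u \in A, v \in B & a = f u v]) /\
  (forall u v, u \in A -> v \in B -> (a <= f u v)%N).

(* Main.v *)
Require Import Defs.
From HB Require Import structures.
From mathcomp Require Import all_boot all_order all_algebra.
From mathcomp Require Import boolp zify ring.

(** The rank one module L_I has a presentation with one generator e_c at each
    vertex c (the element 1 there) and one relation for each arrow; generators and
    relations alike generate a sum of projectives B e_c, which are the rank one
    modules of the intervals (c, c+k]. Each map involved is, at a vertex i, a matrix of powers of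
    t, whose exponents are differences of the numbers wt I c i: the exponent at i
    of the map B e_c -> L_I sending e_c to 1. These numbers satisfy two difference
    equations, one in i ([wt_vertex]) and one in c ([wt_source]), and exactness
    reduces to them ([exact_aug], [exact_syz2]). The kernel of the presentation
    has rank one: it is L_(I+k), embedded in B e_c with exponent
    wt_max I i - wt I c i, where wt_max I i is the maximum of wt I c i over c.

    By dimension shifting ([comparison]), Ext^2(L_I, L_J) is the quotient of
    Hom(L_(I+k), L_J) by the homomorphisms that extend to the projective. The
    former is free of rank one over F[t] ([mono_hom_gen]). The latter are generated
    by the composites L_(I+k) -> B e_c -> L_J, whose exponent at the vertex i is
    ext_wt I J c i. As functions of i, these differ from the exponent of a generator
    of Hom(L_(I+k), L_J), whose minimum is 0, by constants; hence the quotient is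
    F[t]/(t^a) with a the minimum of ext_wt I J c i over all c and i
    ([Ext2_iso]).

    The difference equations show that ext_wt descends to a pair with c in V and
    i - k in U ([ext_wt_descent]), and at c = v, i = u + k its value is a_uv
    ([auv_ext_wt]). As t^a and t^b define isomorphic quotients only for a = b
    ([truncated_poly_le]), this determines the exponent. *)

Set Implicit Arguments.
Unset Strict Implicit.
Unset Printing Implicit Defensive.

Import GRing.Theory.
Local Open Scope ring_scope.

(** * Quotient modules *)

Lemma quot_lmod_iso (R : pzRingType) (V W : lmodType R) (S : submodClosed V)
    (S' : submodClosed W) (phi : {linear V -> W}) :
  (forall v, phi v \in S' <-> v \in S) -> (forall w, exists v, w - phi v \in S') ->
  lmod_isomorphic (quot_lmod S') (quot_lmod S).
Proof.
move=> phiS phi_surj.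
have piE (u v : W) : (quot_pi S' u = quot_pi S' v) <-> (u - v \in S').
  by split=> [/eqP|uv]; last apply/eqP; rewrite quot_pi_eq.
have piE0 (u v : V) : (quot_pi S u = quot_pi S v) <-> (u - v \in S).
  by split=> [/eqP|uv]; last apply/eqP; rewrite quot_pi_eq.
have pi_phi u v : quot_pi S' (phi u) = quot_pi S' (phi v) <-> quot_pi S u = quot_pi S v.
  by rewrite piE piE0 -linearB; apply: phiS.
have lift x : exists v, x = quot_pi S' (phi v).
  have [w ->] := quot_pi_surj x; have [v wv] := phi_surj w.
  by exists v; apply/piE.
pose f x := quot_pi S (sval (cid (lift x))).
have fE v : f (quot_pi S' (phi v)) = quot_pi S v.
  by rewrite /f; case: cid => u /= uv; apply/pi_phi.
have f_lin : linear f.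
  move=> c x y; have [u ->] := lift x; have [v ->] := lift y; rewrite !fE.
  have -> : c *: quot_pi S' (phi u) + quot_pi S' (phi v) = quot_pi S' (phi (c *: u + v)).
    by rewrite linearP quot_piD -quot_scale_pi.
  by rewrite fE quot_piD -quot_scale_pi.
pose f_linear := GRing.isLinear.Build R _ _ _ f f_lin.
pose fL : {linear quot_lmod S' -> quot_lmod S} := HB.pack f f_linear.
exists fL; exists (fun y => quot_pi S' (phi (sval (cid (quot_pi_surj y))))) => [x|y] /=.
  by have [v ->] := lift x; rewrite fE; case: cid => u /= uv; apply/pi_phi.
by rewrite fE; case: cid.
Qed.

Lemma quot_pi_eq0 (R : pzRingType) (V : lmodType R) (S : submodClosed V) v :
  quot_pi S v = 0 <-> v \in S.
Proof.
have pi0 : quot_pi S 0 = 0.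
  by apply: (addrI (quot_pi S 0)); rewrite -quot_piD !addr0.
rewrite -pi0; split=> [/eqP|vS]; last apply/eqP; by rewrite quot_pi_eq subr0.
Qed.

(** Both quotients being isomorphic to E, the power t^a kills E, hence kills
    F[t]/(t^b), so t^b divides t^a. Applied twice, this shows that the exponent
    is an invariant of the module. *)
Lemma truncated_poly_le (F : fieldType) (E : lmodType {poly F}) a b :
  lmod_isomorphic E (truncated_poly F a) -> lmod_isomorphic E (truncated_poly F b) ->
  (b <= a)%N.
Proof.
move=> [f /bij_inj f_inj] [g [h hK gK]].
pose one : truncated_poly F b := quot_pi (@Xn_ideal F b) (1 : {poly F}).
have killed (x : E) : 'X^a *: x = 0.
  apply: f_inj; rewrite linearZ linear0 /=; have [p ->] := quot_pi_surj (f x).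
  by rewrite [_ *: _]quot_scale_pi; apply/quot_pi_eq0/dvdp_mulr.
have : 'X^a *: one = 0 by rewrite -[one]gK -linearZ killed linear0.
rewrite [_ *: _]quot_scale_pi => /quot_pi_eq0.
rewrite [_ *: _]mulr1 => /= ba; rewrite -(@dvdp_Pexp2l F 'X) //.
by rewrite size_polyX.
Qed.

(** * Lifting along maps out of projectives *)

Section Image.
Variables (F : fieldType) (n k : nat) (Q N : bmod F n k) (d : bhom Q N).

(** Projectivity is stated for surjections only, so that lifting through a map
    that is not onto requires its image as a B-module. The carrier at each vertex
    is the subtype of the vectors that are reached. *)
Definition im_pred i : {pred N i} := fun w => `[< exists v, d i v = w >].

Fact im_submod i : submod_closed (@im_pred i).
Proof.
split=> [|c u v]; first by apply/asboolP; exists 0; apply: bhom0.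
move=> /asboolP[u' <-] /asboolP[v' <-]; apply/asboolP.
by exists (c *: u' + v'); apply: bhom_linear.
Qed.
HB.instance Definition _ i :=
  GRing.isSubmodClosed.Build F (N i) (@im_pred i) (@im_submod i).

Record im_elt i := ImElt { im_val : N i; im_valP : im_val \in @im_pred i }.
HB.instance Definition _ i := [isSub for @im_val i].
HB.instance Definition _ i := [Choice of im_elt i by <:].
HB.instance Definition _ i := [SubChoice_isSubLmodule of im_elt i by <:].

Fact im_xP i (v : im_elt (i - 1)) : xmap N i (im_val v) \in @im_pred i.
Proof.
by case: v => _ /= /asboolP[v <-]; apply/asboolP; exists (xmap Q i v); apply: bhom_x.
Qed.
Fact im_yP i (v : im_elt i) : ymap N i (im_val v) \in @im_pred (i - 1).
Proof.
by case: v => _ /= /asboolP[v <-]; apply/asboolP; exists (ymap Q i v); apply: bhom_y.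
Qed.
Definition im_x i (v : im_elt (i - 1)) : im_elt i := ImElt (im_xP v).
Definition im_y i (v : im_elt i) : im_elt (i - 1) := ImElt (im_yP v).

Fact im_x_linear i : linear (@im_x i).
Proof. by move=> c u v; apply: val_inj; rewrite /= !linearP. Qed.
Fact im_y_linear i : linear (@im_y i).
Proof. by move=> c u v; apply: val_inj; rewrite /= !linearP. Qed.
HB.instance Definition _ i := GRing.isLinear.Build F (im_elt (i - 1)) (im_elt i) *:%R
  (@im_x i) (@im_x_linear i).
HB.instance Definition _ i := GRing.isLinear.Build F (im_elt i) (im_elt (i - 1)) *:%R
  (@im_y i) (@im_y_linear i).

Definition im_rep : quiver_rep F n := @QuiverRep F n im_elt im_x im_y.

Fact im_xy i (v : im_rep (i - 1)) :
  xmap im_rep (i - 1) (ymap im_rep (i - 1) v) = ymap im_rep i (xmap im_rep i v).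
Proof. by apply: val_inj; apply: bmod_xy. Qed.

Lemma im_val_xpath m i (v : im_rep (back m i)) :
  im_val (xpath im_rep m i v) = xpath N m i (im_val v).
Proof. by elim: m v => //= m IH v; rewrite IH. Qed.

Lemma im_val_ypath m i (v : im_rep i) :
  im_val (ypath im_rep m i v) = ypath N m i (im_val v).
Proof. by elim: m => //= m ->. Qed.

(** The relation x^k = y^(n-k) compares vectors at two vertices that are only
    propositionally equal, so injectivity of the inclusion is needed in the
    total space. *)
Lemma im_Tagged i j (u : im_rep i) (v : im_rep j) :
  Tagged (Defs.space N) (im_val u) = Tagged (Defs.space N) (im_val v) ->
  Tagged (Defs.space im_rep) u = Tagged (Defs.space im_rep) v.
Proof.
move=> E; have ij : i = j by have := congr1 (@tag _ _) E.
case: _ / ij v E => v /eqP; rewrite eq_Tagged => /eqP E.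
by congr Tagged; apply: val_inj.
Qed.

Fact im_xk_yk i (v : im_rep (back k i)) :
  Tagged (Defs.space im_rep) (xpath im_rep k i v) =
  Tagged (Defs.space im_rep) (ypath im_rep (n - k) (back k i) v).
Proof.
by apply: im_Tagged; rewrite im_val_xpath im_val_ypath; apply: bmod_xk_yk.
Qed.

Definition im_bmod : bmod F n k := BMod im_xy im_xk_yk.

Definition im_incl : bhom im_bmod N.
Proof. by exists (fun i v => im_val v) => //. Defined.

Lemma im_factor (M : bmod F n k) (f : bhom M N) :
  (forall i v, exists w, d i w = f i v) ->
  exists g : bhom M im_bmod, bhom_comp im_incl g = f.
Proof.
move=> fd; have fP i v : f i v \in @im_pred i by apply/asboolP.
unshelve eexists; first exists (fun i v => ImElt (fP i v)).
- by move=> i c u v; apply: val_inj; apply: bhom_linear.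
- by move=> i v; apply: val_inj; apply: bhom_x.
- by move=> i v; apply: val_inj; apply: bhom_y.
by apply: bhomP.
Qed.

End Image.

(** * Computing the second extension group from a partial resolution *)

Section Comparison.
Variables (F : fieldType) (n k : nat).
Implicit Types M N K : bmod F n k.

Definition bhom_id M : bhom M M.
Proof. by exists (fun i v => v). Defined.

Lemma bhomE M N (f g : bhom M N) i v : f = g -> f i v = g i v.
Proof. by move->. Qed.

Lemma bhomB M N (f : bhom M N) i u v : f i (u - v) = f i u - f i v.
Proof. by rewrite addrC -scaleN1r bhom_linear scaleN1r addrC. Qed.

Lemma bhomD M N (f : bhom M N) i u v : f i (u + v) = f i u + f i v.
Proof. by rewrite -[u]scale1r bhom_linear !scale1r. Qed.

Lemma bhomZ M N (f : bhom M N) i a v : f i (a *: v) = a *: f i v.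
Proof. by rewrite -[in LHS](addr0 (a *: v)) bhom_linear bhom0 addr0. Qed.

Lemma bhom_inj M N (f : bhom M N) i :
  (forall v, f i v = 0 -> v = 0) -> injective (f i).
Proof. by move=> f0 u v uv; apply/subr0_eq/f0; rewrite bhomB uv subrr. Qed.

(** Replace the target by the image of d, onto which d is surjective. *)
Lemma projective_lift P Q N (d : bhom Q N) (f : bhom P N) :
  projective P -> (forall i v, exists w, d i w = f i v) ->
  exists h : bhom P Q, bhom_comp d h = f.
Proof.
move=> projP /im_factor[f' f'E].
have [d' d'E] : exists g : bhom Q (im_bmod d), bhom_comp (im_incl d) g = d.
  by apply: im_factor => i v; exists v.
have d'_surj : surjective d'.
  move=> i [w w_im]; have /asboolP[v vw] := w_im; exists v; apply: val_inj.
  by rewrite /= -vw -[in RHS]d'E.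
have [h hE] := projP _ _ d' f' d'_surj; exists h.
apply: bhomP => i v; rewrite -(bhomE v f'E) -hE /=.
by have /= <- := bhomE (h i v) d'E.
Qed.

Variables (M N : bmod F n k) (P : projective_resolution M).
Variables (L Q1 Q0 : bmod F n k).
Variables (iota : bhom L Q1) (d : bhom Q1 Q0) (aug : bhom Q0 M).
Hypotheses (proj1 : projective Q1) (proj0 : projective Q0).
Hypotheses (iota_inj : forall i v, iota i v = 0 -> v = 0).
Hypotheses (exact1 : exact_at iota d) (exact0 : exact_at d aug).
Hypothesis aug_surj : surjective aug.

(** The dimension shift Ext^2(M, N) = Hom(L, N) / Hom(Q1, N) for an exact
    sequence 0 -> L -> Q1 -> Q0 -> M -> 0 with projective middle terms, in the
    form of a map phi from the given resolution whose pullback f |-> f phi induces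
    the isomorphism. Comparison maps are built in both directions; the homotopies
    between their composites and the identities give that f phi is a coboundary
    only if f extends to Q1, and that every cocycle is cohomologous to some f phi. *)
Lemma comparison : exists phi : bhom (P 2%N) L,
  [/\ forall f : bhom L N, bhom_comp f phi \in @cocycle _ _ _ _ P N 2%N,
      forall f : bhom L N, is_coboundary (P := P) (m := 2%N) (bhom_comp f phi) <->
        exists g : bhom Q1 N, f = bhom_comp g iota &
      forall g : bhom (P 2%N) N, g \in @cocycle _ _ _ _ P N 2%N ->
        exists f : bhom L N, is_coboundary (P := P) (m := 2%N) (g - bhom_comp f phi)].
Proof.
have PP := @res_projective _ _ _ _ P; have Pex := @res_exact _ _ _ _ P.
have Pex0 := @res_exact0 _ _ _ _ P.
have dd0 i v : res_aug P i (res_d P 0 i v) = 0 by apply/Pex0; exists v.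
have dd m i v : res_d P m i (res_d P m.+1 i v) = 0 by apply/Pex; exists v.
have qq1 i v : d i (iota i v) = 0 by apply/exact1; exists v.
have qq0 i v : aug i (d i v) = 0 by apply/exact0; exists v.
have iota_injective i : injective (iota i) by apply/bhom_inj/iota_inj.
have [phi0 phi0E] := PP 0%N _ _ aug (res_aug P) aug_surj.
have {}phi0E i v : aug i (phi0 i v) = res_aug P i v by rewrite -phi0E.
have [phi1 phi1E] : exists h, bhom_comp d h = bhom_comp phi0 (res_d P 0).
  by apply: projective_lift => // i v; apply/exact0; rewrite /= phi0E dd0.
have {}phi1E i v : d i (phi1 i v) = phi0 i (res_d P 0 i v) by apply: bhomE phi1E.
have [phi2 phi2E] : exists h, bhom_comp iota h = bhom_comp phi1 (res_d P 1).
  by apply: projective_lift => // i v; apply/exact1; rewrite /= phi1E dd bhom0.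
have {}phi2E i v : iota i (phi2 i v) = phi1 i (res_d P 1 i v) by apply: bhomE phi2E.
have [psi0 psi0E] := proj0 aug (@res_aug_surj _ _ _ _ P).
have {}psi0E i v : res_aug P i (psi0 i v) = aug i v by rewrite -psi0E.
have [psi1 psi1E] : exists h, bhom_comp (res_d P 0) h = bhom_comp psi0 d.
  by apply: projective_lift => // i v; apply/Pex0; rewrite /= psi0E qq0.
have {}psi1E i v : res_d P 0 i (psi1 i v) = psi0 i (d i v) by apply: bhomE psi1E.
have psi_lift i l : exists p, res_d P 1 i p = psi1 i (iota i l).
  by apply/Pex; rewrite psi1E qq1 bhom0.
exists phi2; split.
- move=> f; apply/eqP/bhomP => i v /=.
  by rewrite (iota_inj (v := phi2 i _)) ?bhom0 // phi2E dd bhom0.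
- move=> f; split=> [[h hE]|[g ->]]; last first.
    by exists (bhom_comp g phi1); apply: bhomP => i v; rewrite /= phi2E.
  (* The homotopy on the side of Q corrects the map h psi1 into an extension of f. *)
  have [s0 s0E] : exists s, bhom_comp d s = bhom_comp phi0 psi0 - bhom_id Q0.
    by apply: projective_lift => // i v; apply/exact0; rewrite /= bhomB phi0E psi0E subrr.
  have {}s0E i v : d i (s0 i v) = phi0 i (psi0 i v) - v by apply: bhomE s0E.
  have [s1 s1E] : exists s, bhom_comp iota s =
      bhom_comp phi1 psi1 - bhom_id Q1 - bhom_comp s0 d.
    apply: projective_lift => // i v; apply/exact1 => /=.
    by rewrite !bhomB phi1E psi1E s0E subrr.
  have {}s1E i v : iota i (s1 i v) = phi1 i (psi1 i v) - v - s0 i (d i v).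
    exact: bhomE s1E.
  exists (bhom_comp h psi1 - bhom_comp f s1); apply: bhomP => i l /=.
  have [p pE] := psi_lift i l.
  have -> : h i (psi1 i (iota i l)) = f i (phi2 i p) by rewrite -pE; apply/esym/(bhomE _ hE).
  rewrite -bhomB; congr (f i _); apply: iota_injective.
  by rewrite bhomB s1E phi2E pE qq1 bhom0 subr0 opprB addrC subrK.
move=> g /eqP gE.
have {gE} g0 i v : g i (res_d P 2 i v) = 0 by apply: bhomE gE.
(* A cocycle factors through the image of the differential, and so can be
   evaluated on L through psi1. *)
have g_wd i p q : res_d P 1 i p = res_d P 1 i q -> g i p = g i q.
  move=> pq; apply/subr0_eq; rewrite -bhomB.
  have [r <-] : exists r, res_d P 2 i r = p - q by apply/Pex; rewrite bhomB pq subrr.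
  exact: g0.
pose c i l := sval (cid (psi_lift i l)).
have cE i l : res_d P 1 i (c i l) = psi1 i (iota i l) by rewrite /c; case: cid.
unshelve eexists; first exists (fun i l => g i (c i l)).
- move=> i a u v; rewrite -bhom_linear; apply: g_wd.
  by rewrite bhom_linear !cE !bhom_linear.
- by move=> i v; rewrite -bhom_x; apply: g_wd; rewrite bhom_x !cE !bhom_x.
- by move=> i v; rewrite -bhom_y; apply: g_wd; rewrite bhom_y !cE !bhom_y.
(* The homotopy on the side of P shows that g and its pullback differ by a
   coboundary. *)
have [s0 s0E] : exists s, bhom_comp (res_d P 0) s = bhom_comp psi0 phi0 - bhom_id (P 0%N).
  by apply: projective_lift => // i v; apply/Pex0; rewrite /= bhomB psi0E phi0E subrr.
have {}s0E i v : res_d P 0 i (s0 i v) = psi0 i (phi0 i v) - v by apply: bhomE s0E.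
have [s1 s1E] : exists s, bhom_comp (res_d P 1) s =
    bhom_comp psi1 phi1 - bhom_id (P 1%N) - bhom_comp s0 (res_d P 0).
  apply: projective_lift => // i v; apply/Pex => /=.
  by rewrite !bhomB psi1E phi1E s0E subrr.
have {}s1E i v : res_d P 1 i (s1 i v) = psi1 i (phi1 i v) - v - s0 i (res_d P 0 i v).
  exact: bhomE s1E.
exists (- bhom_comp g s1); apply: bhomP => i v /=.
have -> : g i (c i (phi2 i v)) = g i (v + s1 i (res_d P 1 i v)).
  apply: g_wd; rewrite cE phi2E bhomD s1E dd bhom0 subr0.
  by rewrite addrC subrK.
by rewrite bhomD opprD addrA subrr add0r.
Qed.

End Comparison.

(** * Cyclic counting and the exponents of the canonical maps *)

Section Counting.
Variable n : nat.
Hypothesis n_gt1 : (1 < n)%N.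
Implicit Types (A I J : {set 'Z_n}) (c i : 'Z_n).

Lemma Zn_natr_n : n%:R = 0 :> 'Z_n. Proof. exact: pchar_Zp. Qed.

Lemma Zn_ltn i : (val i < n)%N.
Proof. by rewrite -[X in (_ < X)%N](Zp_cast n_gt1) ltn_ord. Qed.

Lemma Zn_valK i : (val i)%:R = i. Proof. exact: natr_Zp. Qed.

Lemma Zn_val_nat m : val (m%:R : 'Z_n) = (m %% n)%N.
Proof. exact: val_Zp_nat. Qed.

Lemma card_Zn : #|{: 'Z_n}| = n.
Proof. by rewrite card_ord Zp_cast. Qed.

Definition count_after A c m := (\sum_(j < m) (c + j.+1%:R \in A)%R)%N.
Arguments count_after A c%_R m%_N.

Lemma count_afterD A c m1 m2 :
  count_after A c (m1 + m2) = (count_after A c m1 + count_after A (c + m1%:R)%R m2)%N.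
Proof.
rewrite /count_after big_split_ord /=; congr (_ + _)%N.
by apply: eq_bigr => j _; rewrite -addnS natrD addrA.
Qed.

Lemma count_after0 A c : count_after A c 0 = 0%N.
Proof. exact: big_ord0. Qed.

Lemma count_after1 A c : count_after A c 1 = (c + 1 \in A)%R.
Proof. exact: big_ord1. Qed.

Lemma count_afterS A c m : count_after A c m.+1 = (count_after A c m + (c + m.+1%:R \in A)%R)%N.
Proof. by rewrite /count_after big_ord_recr. Qed.

Lemma count_after_head A c m : count_after A (c - 1) m.+1 = ((c \in A) + count_after A c m)%N.
Proof. by rewrite -[m.+1]add1n count_afterD count_after1 !subrK. Qed.

Lemma count_after_le A c m : (count_after A c m <= m)%N.
Proof.
rewrite -[X in (_ <= X)%N]card_ord -sum1_card; apply: leq_sum => j _.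
exact: leq_b1.
Qed.

Lemma sum_Zn (f : 'Z_n -> nat) c : (\sum_x f x = \sum_(j < n) f (c + j%:R)%R)%N.
Proof.
rewrite (reindex_inj (addrI c)) /=.
have -> : (\sum_(j < n) f (c + j%:R)%R = \sum_(0 <= j < (Zp_trunc n).+2) f (c + j%:R)%R)%N.
  by rewrite Zp_cast // big_mkord.
by rewrite big_mkord; apply: eq_bigr => j _; rewrite natr_Zp.
Qed.

Lemma card_count_after A c : #|A| = count_after A c n.
Proof.
rewrite -sum1_card big_mkcond (sum_Zn _ (c + 1)); apply: eq_bigr => j _.
by rewrite -addrA nat1r; case: (_ \in A).
Qed.

Lemma card_cint A c i : #|A :&: cint c i| = count_after A c (val (i - c)).
Proof.
rewrite /cint; have := Zn_ltn (i - c); move: (val (i - c)) => m lt_mn.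
rewrite -sum1_card big_mkcond (sum_Zn _ c).
rewrite (eq_bigr (fun j : 'I_n =>
    ((c + (j : nat)%:R \in A)%R && (0 < j <= m)) : nat)%N); last first.
  by move=> j _; rewrite !inE [(c + _)%R]addrC addrK Zn_val_nat modn_small.
rewrite -(big_mkord xpredT (fun j => (c + j%:R \in A)%R && (0 < j <= m) : nat)%N).
rewrite (big_cat_nat _ (n := m.+1)) //= big_nat_recl // ltnn andbF add0n.
rewrite [X in (_ + X)%N]big_nat_cond [X in (_ + X)%N]big1 ?addn0; last first.
  by move=> j /andP[/andP[lt_j _] _]; rewrite [(j <= m)%N]leqNgt lt_j !andbF.
by rewrite big_mkord; apply: eq_bigr => j _; rewrite /= ltn_ord andbT.
Qed.

Variable k : nat.
Hypothesis k_ltn : (k < n)%N.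

Lemma count_after_leC A c d : (d <= n)%N -> (count_after A c d <= #|A|)%N.
Proof.
by move=> /subnKC dn; rewrite (card_count_after A c) -dn count_afterD leq_addr.
Qed.

Definition dist c i : nat := val (i - c).
Arguments dist c%_R i%_R.

Lemma dist_ltn c i : (dist c i < n)%N. Proof. exact: Zn_ltn. Qed.

Lemma dist_add c i : c + (dist c i)%:R = i.
Proof. by rewrite Zn_valK addrC subrK. Qed.

Lemma dist_addn c d : (d < n)%N -> dist c (c + d%:R) = d.
Proof. by move=> dn; rewrite /dist addrC addKr Zn_val_nat modn_small. Qed.

Lemma dist_id c : dist c c = 0%N.
Proof. by rewrite /dist subrr. Qed.

(** The projective B e_c is the rank one module of the interval (c, c+k]: paths
    of x's of length at most k, and otherwise paths of y's, form a basis over F[t]. *)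
Definition proj_set c : {set 'Z_n} := cint c (c + k%:R).
Arguments proj_set c%_R.

Lemma proj_setE c i : (i \in proj_set c) = (0 < dist c i <= k)%N.
Proof. by rewrite inE -/(dist c i) -/(dist c _) dist_addn. Qed.

Lemma proj_set_prev c i : (i \in proj_set c) = (dist c (i - 1) < k)%N.
Proof.
rewrite proj_setE; have := dist_ltn c (i - 1); set d := dist c (i - 1) => lt_dn.
have ci : c + d.+1%:R = i by rewrite -natr1 addrA dist_add subrK.
have [dn|dn] := ltnP d.+1 n; first by rewrite -ci dist_addn.
have nE : d.+1 = n by apply/eqP; rewrite eqn_leq lt_dn.
by rewrite -ci nE Zn_natr_n addr0 dist_id; lia.
Qed.

Lemma card_proj_set c : #|proj_set c| = k.
Proof.
rewrite -[proj_set c]setTI card_cint -/(dist c _) dist_addn //.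
rewrite -[RHS]card_ord -sum1_card; apply: eq_bigr => j _.
by rewrite inE.
Qed.

(** For d <= k this is the number of elements outside I in (c, c+d]; for d >= k
    it is the number of elements of I in (c+d, c+n]. A single formula serves both
    ranges because I has k elements, and d = n may be used in place of d = 0. *)
Definition height I c d : nat := minn d k - count_after I c d.
(** The map B e_c -> L_I sending the generator to 1 at the vertex c is, at the
    vertex i, multiplication by t to this power. *)
Definition wt I c i : nat := height I c (dist c i).
Arguments wt I c%_R i%_R.

Lemma wtE I c i d : #|I| = k -> (d <= n)%N -> c + d%:R = i -> wt I c i = height I c d.
Proof.
move=> cI; rewrite leq_eqVlt => /orP[/eqP -> | dn] <-; last by rewrite /wt dist_addn.
rewrite Zn_natr_n addr0 /wt dist_id /height -card_count_after cI count_after0.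
lia.
Qed.

Lemma wt_id I c : wt I c c = 0%N.
Proof. by rewrite /wt dist_id /height min0n. Qed.

Lemma count_height I c d : #|I| = k -> (d <= n)%N ->
  (count_after I c d + height I c d = minn d k)%N.
Proof.
move=> cI dn; have := count_after_le I c d; have := count_after_leC I c dn.
rewrite /height; lia.
Qed.

(** Compatibility of the map B e_c -> L_I with the arrows between i-1 and i. *)
Lemma wt_vertex I c i : #|I| = k ->
  (wt I c i + (i \in I) = wt I c (i - 1) + (i \in proj_set c))%N.
Proof.
move=> cI; have := dist_ltn c (i - 1); set d := dist c (i - 1) => lt_dn.
have ci : c + d.+1%:R = i by rewrite -natr1 addrA dist_add subrK.
rewrite (wtE cI _ ci) // /wt proj_set_prev -/d.
have := count_height c cI lt_dn; have := count_height c cI (ltnW lt_dn).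
rewrite count_afterS ci; lia.
Qed.

(** Of the two maps between B e_(a-1) and B e_a given by the arrow a, one is at
    the vertex i the identity of F[t] and the other multiplication by t. Which one
    depends on whether i is reached from a in fewer than k steps. *)
Lemma wt_source I a i : #|I| = k ->
  (wt I a i + (dist a i < k) = wt I (a - 1) i + (a \in I))%N.
Proof.
move=> cI; have := dist_ltn a i; set d := dist a i => lt_dn.
have ai : a - 1 + d.+1%:R = i by rewrite -nat1r addrA subrK dist_add.
rewrite (wtE cI _ ai) // /wt -/d.
have := count_height (a - 1) cI lt_dn; have := count_height a cI (ltnW lt_dn).
rewrite count_after_head; lia.
Qed.

(** The largest of the exponents wt I c i over all c. It is attained opposite
    to i: wt I c i increases as c moves away from i either way, and the two ways
    meet at c = i - k. *)
Definition wt_max I i : nat := wt I (i - k%:R) i.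
Arguments wt_max I i%_R.

Lemma wt_maxE I i : #|I| = k ->
  (wt_max I i + count_after I (i - k%:R) k = k)%N.
Proof.
move=> cI; rewrite /wt_max (@wtE _ _ _ k) ?subrK ?(ltnW k_ltn) //.
by rewrite addnC (count_height _ cI (ltnW k_ltn)) minnn.
Qed.

Lemma wt_max_vertex I i : #|I| = k ->
  (wt_max I i + (i \in I) = wt_max I (i - 1) + ((i - k%:R)%R \in I))%N.
Proof.
move=> cI; have := wt_maxE i cI; have := wt_maxE (i - 1) cI.
have := count_after_head I (i - k%:R) k; rewrite count_afterS.
have -> : i - k%:R - 1 + k.+1%:R = i by rewrite -natr1 addrACA subrK addNr addr0.
rewrite [i - 1 - _]addrAC.
move: (count_after _ _ _) (count_after _ _ _) (wt_max _ _) (wt_max _ _); lia.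
Qed.

Lemma wt_le_max I c i : #|I| = k -> (wt I c i <= wt_max I i)%N.
Proof.
move=> cI; have := wt_maxE i cI; have := dist_ltn c i; have := dist_add c i.
rewrite /wt; move: (dist c i) => d ci lt_dn.
have := count_height c cI (ltnW lt_dn).
have [dk|kd] := leqP d k.
  have -> : (count_after I (i - k%:R) k =
     count_after I (i - k%:R) (k - d) + count_after I c d)%N.
    rewrite -[X in count_after I (i - k%:R) X = _](subnK dk) count_afterD natrB //.
    by rewrite addrA subrK -ci addrK.
  have := count_after_le I (i - k%:R) (k - d); lia.
have -> : (count_after I c d = count_after I c (d - k) + count_after I (i - k%:R) k)%N.
  rewrite -[X in count_after I c X = _](subnK (ltnW kd)) count_afterD natrB ?(ltnW kd) //.
  by rewrite addrA ci.
lia.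
Qed.

(** The exponent at the vertex i of the composite L_(I+k) -> B e_c -> L_J, whose
    first factor has exponent wt_max I i - wt I c i (a component of the embedding
    of the second syzygy) and whose second factor has exponent wt J c i. *)
Definition ext_wt I J c i : nat := (wt_max I i - wt I c i + wt J c i)%N.
Arguments ext_wt I J c%_R i%_R.

Lemma ext_wt_vertex I J c i : #|I| = k -> #|J| = k ->
  (ext_wt I J c i + (i \in J) = ext_wt I J c (i - 1) + ((i - k%:R)%R \in I))%N.
Proof.
move=> cI cJ; have := wt_vertex c i cI; have := wt_vertex c i cJ.
have := wt_max_vertex i cI; have := wt_le_max c i cI; have := wt_le_max c (i - 1) cI.
rewrite /ext_wt; lia.
Qed.

Lemma ext_wt_source I J c i : #|I| = k -> #|J| = k ->
  (ext_wt I J c i + (c \in I) = ext_wt I J (c - 1) i + (c \in J))%N.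
Proof.
move=> cI cJ; have := wt_source c i cI; have := wt_source c i cJ.
have := wt_le_max c i cI; have := wt_le_max (c - 1) i cI.
rewrite /ext_wt; lia.
Qed.

Lemma card_cintD A c i :
  (#|cint c i :\: A| + count_after A c (dist c i) = dist c i)%N.
Proof.
rewrite /dist -card_cint setIC addnC cardsID -[cint c i]setTI card_cint.
rewrite /count_after (eq_bigr (fun _ => 1%N)); last by move=> j _; rewrite inE.
by rewrite sum_nat_const card_ord muln1.
Qed.

Lemma card_cint_dist c i : #|cint c i| = dist c i.
Proof.
rewrite -[cint c i]setTI card_cint /count_after (eq_bigr (fun _ => 1%N)).
  by rewrite sum_nat_const card_ord muln1.
by move=> j _; rewrite inE.
Qed.

(** The two cases of the definition of a_uv are the two ranges of the exponents
    from v to u + k: u is to the left of v exactly when u + k lies in (v, v+k]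
    or is v itself. *)
Lemma auv_ext_wt I J u v : #|I| = k -> #|J| = k -> u != v ->
  auv k I J u v = ext_wt I J v (u + k%:R).
Proof.
move=> cI cJ uv; have lt_en := dist_ltn u v; have := dist_add u v.
have e_gt0 : (0 < dist u v)%N.
  by rewrite lt0n; apply: contraNneq uv => e0; rewrite -(dist_add u v) e0 addr0.
have := wt_maxE (u + k%:R) cI; rewrite addrK /ext_wt /auv /left_of card_cint_dist.
have := card_cintD I u v; move: (dist u v) lt_en e_gt0 => e lt_en e_gt0 Ie maxE ue.
case: leqP => [ek|ke].
  (* From v, the vertex u + k is reached in k - e steps, where e is the length
     of (u, v]. *)
  have vuk : v + (k - e)%:R = u + k%:R by rewrite natrB // -ue [(k%:R - _)%R]addrC addrA addrK.
  have dvuk : dist v (u + k%:R) = (k - e)%N by rewrite -vuk dist_addn; lia.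
  have := card_cintD J v (u + k%:R); rewrite dvuk.
  rewrite !(wtE _ _ vuk) //; try lia.
  have := count_afterD I u e (k - e); rewrite ue subnKC //.
  have := @count_height I v (k - e) cI ltac:(lia).
  have := @count_height J v (k - e) cJ ltac:(lia).
  lia.
(* Here v comes after u + k, which is reached from v by first going round
   to u. *)
have vu : v + (n - e)%:R = u by rewrite natrB ?(ltnW lt_en) // Zn_natr_n add0r -ue addrK.
have vuk : v + (n - e + k)%:R = u + k%:R by rewrite natrD addrA vu.
have ukv : u + k%:R + (e - k)%:R = v by rewrite natrB ?(ltnW ke) // addrA addrAC addrK ue.
rewrite !(wtE _ _ vuk) //; try lia.
have -> : u - (n - k)%:R = u + k%:R by rewrite natrB ?(ltnW k_ltn) // Zn_natr_n add0r opprK.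
have dukv : dist (u + k%:R) v = (e - k)%N by rewrite -[X in dist _ X]ukv dist_addn; lia.
have dvu : dist v u = (n - e)%N by rewrite -[X in dist _ X]vu dist_addn; lia.
rewrite !card_cint -!/(dist _ _) dukv dvu.
have := count_afterD I v (n - e) k; rewrite vu.
have := count_afterD J v (n - e + k) (e - k); rewrite vuk.
have -> : (n - e + k + (e - k) = n)%N by lia.
rewrite -card_count_after cJ.
have := @count_height I v (n - e + k) cI ltac:(lia).
have := @count_height J v (n - e + k) cJ ltac:(lia).
lia.
Qed.

Lemma walk_up (P Q : pred 'Z_n) x z : Q z -> P x ->
  (forall y, P y -> ~~ Q y -> P (y + 1)) -> exists y, P y && Q y.
Proof.
move=> Qz Px step; move: Qz; rewrite -(dist_add x z).
move: (dist x z) => m; elim: m x Px => [|m IH] x Px.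
  by rewrite addr0 => Qx; exists x; rewrite Px.
have [Qx _|nQx] := boolP (Q x); first by exists x; rewrite Px.
by rewrite -nat1r addrA; apply: IH; apply: step.
Qed.

Lemma walk_down (P Q : pred 'Z_n) x z : Q z -> P x ->
  (forall y, P y -> ~~ Q y -> P (y - 1)) -> exists y, P y && Q y.
Proof.
move=> Qz Px step.
have [||y|y] := @walk_up (fun y => P (- y)) (fun y => Q (- y)) (- x) (- z); rewrite ?opprK //.
  by move=> Py nQy; rewrite opprD; apply: step.
by exists (- y).
Qed.

Hypothesis k_gt0 : (0 < k)%N.

(** By the two difference equations, ext_wt does not increase when c moves
    forward into I or backward out of the complement of I, nor when i - k moves
    backward out of I or forward within the complement of I. Such moves end at a
    vertex of V for c and at a vertex of U for i - k. *)
Lemma ext_wt_descent I J c i : #|I| = k -> #|J| = k ->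
  exists u v, [/\ u \in starts I, v \in ends I &
                 (ext_wt I J v (u + k%:R) <= ext_wt I J c i)%N].
Proof.
move=> cI cJ; set m := ext_wt I J c i.
have [z1 z1I] : exists z, z \in I by apply/card_gt0P; rewrite cI.
have [z0 z0I] : exists z, z \notin I.
  have /card_gt0P[z] : (0 < #|~: I|)%N by have := cardsC I; rewrite cI card_Zn; lia.
  by rewrite inE; exists z.
have [|//|y Py yI|c1 /andP[c1m c1I]] :=
  @walk_up (fun y => ext_wt I J y i <= m)%N (fun y => y + 1 \notin I) c (z0 - 1).
- by rewrite subrK.
- move: yI (ext_wt_source (y + 1) i cI cJ); rewrite negbK addrK => -> E.
  by apply: leq_trans Py; move: E; case: (_ \in J); lia.
have [//||y /andP[Py y1I] yI|v /andP[/andP[vm v1I] vI]] :=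
  @walk_down (fun y => (ext_wt I J y i <= m)%N && (y + 1 \notin I)) (fun y => y \in I) c1 z1.
- by rewrite c1m.
- rewrite subrK yI andbT; have := ext_wt_source y i cI cJ; rewrite (negbTE yI).
  by move=> E; apply: leq_trans Py; rewrite -[leqRHS]addn0 E leq_addr.
have [//||y Py yI|u1 /andP[u1m u1I]] :=
  @walk_down (fun y => ext_wt I J v (y + k%:R) <= m)%N (fun y => y \notin I) (i - k%:R) z0.
- by rewrite subrK.
- move: yI (ext_wt_vertex v (y + k%:R) cI cJ); rewrite negbK addrK => -> E.
  by rewrite addrAC; apply: leq_trans Py; rewrite -(leq_add2r true) -E leq_add2l leq_b1.
have [||y /andP[Py yI] y1I|u /andP[/andP[um uI] u1I']] :=
  @walk_up (fun y => (ext_wt I J v (y + k%:R) <= m)%N && (y \notin I))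
    (fun y => y + 1 \in I) u1 (z1 - 1).
- by rewrite subrK.
- by rewrite u1m.
- rewrite y1I andbT; have := ext_wt_vertex v (y + 1 + k%:R) cI cJ; rewrite addrK.
  rewrite (negbTE y1I) addn0 [y + 1 + _ - 1]addrAC addrK => E.
  by apply: leq_trans Py; rewrite -E leq_addr.
by exists u, v; rewrite !inE uI u1I' vI v1I.
Qed.

Lemma starts_ends_neq I u v : u \in starts I -> v \in ends I -> u != v.
Proof. by rewrite !inE => /andP[uI _] /andP[vI _]; apply: contraNneq uI => ->. Qed.

Lemma min_auvP I J a : #|I| = k -> #|J| = k ->
  is_min2 (starts I) (ends I) (auv k I J) a ->
  (exists v i, v \in ends I /\ a = ext_wt I J v i) /\
  (forall c i, a <= ext_wt I J c i)%N.
Proof.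
move=> cI cJ [[u [v [uI vI aE]]] a_le]; split.
  by exists v, (u + k%:R); rewrite -auv_ext_wt // (starts_ends_neq uI vI).
move=> c i; have [u' [v' [u'I v'I le_m]]] := ext_wt_descent c i cI cJ.
by apply: leq_trans le_m; rewrite -auv_ext_wt ?(starts_ends_neq u'I v'I) ?a_le.
Qed.

Lemma min_auv_exists I J : #|I| = k -> #|J| = k ->
  exists a, is_min2 (starts I) (ends I) (auv k I J) a.
Proof.
move=> cI cJ; have [u0 [v0 [u0I v0I _]]] := ext_wt_descent 0 0 cI cJ.
pose S := [pred p : 'Z_n * 'Z_n | (p.1 \in starts I) && (p.2 \in ends I)].
have S0 : S (u0, v0) by rewrite /= u0I.
case: (arg_minnP (fun p => auv k I J p.1 p.2) S0) => -[u v] /andP[uI vI] /= le_uv.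
exists (auv k I J u v); split; first by exists u, v.
by move=> u' v' u'I v'I; apply: (le_uv (u', v')); rewrite /= u'I.
Qed.

End Counting.

(** * The polynomial action *)

Section Action.
Variables (F : fieldType) (n k : nat).
Implicit Types M N : bmod F n k.

Lemma bmod_act1 M i (v : M i) : bmod_act 1 v = v.
Proof. by rewrite /bmod_act poly_actC scale1r. Qed.

Lemma bmod_act0 M i (v : M i) : bmod_act 0 v = 0.
Proof. by rewrite /bmod_act -polyC0 poly_actC scale0r. Qed.

Lemma bmod_actX M i (v : M i) : bmod_act 'X v = t_act M i v.
Proof. by rewrite /bmod_act -['X]mul1r poly_actMX poly_actC scale1r. Qed.

Lemma bhom_act M N (f : bhom M N) p i v : f i (bmod_act p v) = bmod_act p (f i v).
Proof.
rewrite /bmod_act; elim/poly_ind: p v => [|p c IH] v.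
  by rewrite -polyC0 !poly_actC !scale0r bhom0.
by rewrite !poly_actDl bhomD !poly_actMX !poly_actC IH bhom_t bhomZ.
Qed.

Lemma bmod_actDl M p q i (v : M i) : bmod_act (p + q) v = bmod_act p v + bmod_act q v.
Proof. exact: poly_actDl. Qed.

Lemma bmod_actM M p q i (v : M i) : bmod_act (p * q) v = bmod_act p (bmod_act q v).
Proof. exact: poly_actM. Qed.

Lemma bmod_actZ M a p i (v : M i) : bmod_act (a *: p) v = a *: bmod_act p v.
Proof. by rewrite -mul_polyC bmod_actM [in LHS]/bmod_act poly_actC. Qed.
End Action.

(** * The orbit of a generator *)

Section TotalSpace.
Variables (F : fieldType) (n k : nat) (M : bmod F n k).
Local Notation tot := {i : 'Z_n & M i}.
Local Notation tg := (Tagged (Defs.space M)).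

Definition tot_y (s : tot) : tot := tg (ymap M (tag s) (tagged s)).
(** The sum of all M i, on which the arrows become two commuting self-maps. This
    removes the transports between equal vertices from computations with paths. *)
Definition tot_x (s : tot) : tot :=
  tg (xmap M (tag s + 1) (ecast i (M i) (esym (addrK 1 (tag s))) (tagged s))).

Lemma tot_xE i (v : M (i - 1)) : tot_x (tg v) = tg (xmap M i v).
Proof.
suff H j (e : j = i - 1) (w : M j) : tot_x (tg w) = tg (xmap M i (ecast i (M i) e w)).
  exact: (H _ erefl).
have ij : i = j + 1 by rewrite e subrK.
case: _ / (esym ij) e => e; rewrite /tot_x /=.
by rewrite (eq_irrelevance (esym _) e).
Qed.

Lemma tot_cast (s : tot) i : tag s = i -> exists v : M i, s = tg v.
Proof. by case: s => j v /= <-; exists v. Qed.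

Lemma tot_xy s : tot_x (tot_y s) = tot_y (tot_x s).
Proof.
have [i [v ->]] : exists i (v : M (i - 1)), s = tg v.
  by exists (tag s + 1); apply/tot_cast/esym/addrK.
by rewrite tot_xE /tot_y /= tot_xE bmod_xy.
Qed.

Lemma tot_t i (v : M i) : tot_x (tot_y (tg v)) = tg (t_act M i v).
Proof. exact: tot_xE. Qed.

Lemma iter_tot_x m i (v : M (back m i)) : iter m tot_x (tg v) = tg (xpath M m i v).
Proof. by elim: m v => //= m IH v; rewrite -IH -tot_xE -iterSr. Qed.

Lemma iter_tot_y m i (v : M i) : iter m tot_y (tg v) = tg (ypath M m i v).
Proof. by elim: m => //= m ->. Qed.

Lemma tot_xk_yk s : iter k tot_x s = iter (n - k) tot_y s.
Proof.
have [i [v ->]] : exists i (v : M (back k i)), s = tg v.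
  by exists (tag s + k%:R); apply: tot_cast; rewrite backE addrK.
by rewrite iter_tot_x iter_tot_y; apply: bmod_xk_yk.
Qed.

Lemma tag_iter_x m s : tag (iter m tot_x s) = tag s + m%:R.
Proof. by elim: m => [|m IH]; rewrite ?addr0 //= IH -natr1 addrA. Qed.

Lemma tag_iter_y m s : tag (iter m tot_y s) = tag s - m%:R.
Proof. by elim: m => [|m IH]; rewrite ?subr0 //= IH -natr1 opprD addrA. Qed.

Lemma tot_inj i : injective (fun v : M i => tg v).
Proof. by move=> u v /eqP; rewrite eq_Tagged => /eqP. Qed.

Hypotheses (n_gt1 : (1 < n)%N) (k_ltn : (k < n)%N).

(** Starting from m, take x^d m for d <= k steps and y^(n-d) m beyond; the
    relation x^k = y^(n-k) makes the two families agree where they meet. The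
    result is the image of the canonical basis under B e_c -> M, e_c |-> m. *)
Lemma generator_orbit c (m : M c) : exists p : forall i, M i,
  [/\ p c = m,
      forall i, xmap M i (p (i - 1)) = bmod_act (if i \in proj_set k c then 1 else 'X) (p i) &
      forall i, ymap M i (p i) = bmod_act (if i \in proj_set k c then 'X else 1) (p (i - 1))].
Proof.
pose E d := if (d <= k)%N then iter d tot_x (tg m) else iter (n - d) tot_y (tg m).
have tagE d : (d <= n)%N -> tag (E d) = c + d%:R.
  move=> dn; rewrite /E; case: ifP => _; rewrite ?tag_iter_x ?tag_iter_y //=.
  by rewrite natrB // Zn_natr_n // add0r opprK.
have EnE : E n = E 0 by rewrite /E leqNgt k_ltn subnn.
have Ey d : (k <= d)%N -> E d = iter (n - d) tot_y (tg m).
  by rewrite leq_eqVlt /E => /orP[/eqP <-|kd]; [rewrite leqnn tot_xk_yk | rewrite leqNgt kd].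
have Etag i : exists v : M i, E (dist c i) = tg v.
  by apply: tot_cast; rewrite tagE ?dist_add // ltnW // dist_ltn.
pose p i := sval (cid (Etag i)).
have pE i : tg (p i) = E (dist c i) by rewrite /p; case: cid.
(* The vertex i is one step after i - 1; when this step closes the circle, the
   value at d = n replaces the one at d = 0. *)
have pES i : tg (p i) = E (dist c (i - 1)).+1.
  have := dist_ltn n_gt1 c (i - 1); rewrite leq_eqVlt => /orP[/eqP dn|dn].
    rewrite pE dn EnE; congr E.
    have -> : i = c.
      by rewrite -[i](subrK 1) -(dist_add c (i - 1)) -addrA natr1 dn Zn_natr_n // addr0.
    exact: dist_id.
  rewrite pE; congr E; rewrite -[X in dist c X](subrK 1) -{1}(dist_add c (i - 1)).
  by rewrite -addrA natr1 dist_addn.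
have memK := proj_set_prev n_gt1 k_ltn c.
exists p; split=> [|i|i].
- by apply: tot_inj; rewrite pE dist_id.
- apply: tot_inj; rewrite -tot_xE pE memK; case: ltnP => dk.
    by rewrite bmod_act1 pES /E dk ltnW.
  rewrite bmod_actX -tot_t pES !Ey ?(leqW dk) // -iterS subnSK //.
  exact: dist_ltn.
- apply: tot_inj; rewrite -[LHS]/(tot_y (tg (p i))) pES memK; case: ltnP => dk.
    by rewrite bmod_actX -tot_t pE /E dk ltnW // -tot_xy.
  rewrite bmod_act1 pE !Ey ?(leqW dk) // -iterS subnSK //.
  exact: dist_ltn.
Qed.
End TotalSpace.

(** * Direct sums of rank one modules *)

Section DirectSum.
Variables (F : fieldType) (n k : nat).
Hypotheses (n_gt1 : (1 < n)%N) (k_leqn : (k <= n)%N).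
Variables (T : finType) (A : T -> {set 'Z_n}).
Hypothesis cardA : forall t, #|A t| = k.

Definition sum_x (i : 'Z_n) (v : {ffun T -> {poly F}}) : {ffun T -> {poly F}} :=
  [ffun t => rank1_x (A t) i (v t)].
Definition sum_y (i : 'Z_n) (v : {ffun T -> {poly F}}) : {ffun T -> {poly F}} :=
  [ffun t => rank1_y (A t) i (v t)].

Fact sum_x_linear i : linear (sum_x i).
Proof. by move=> a u v; apply/ffunP => t; rewrite !ffunE linearP. Qed.
Fact sum_y_linear i : linear (sum_y i).
Proof. by move=> a u v; apply/ffunP => t; rewrite !ffunE linearP. Qed.
HB.instance Definition _ i := GRing.isLinear.Build F
  {ffun T -> {poly F}} {ffun T -> {poly F}} *:%R (sum_x i) (sum_x_linear i).
HB.instance Definition _ i := GRing.isLinear.Build F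
  {ffun T -> {poly F}} {ffun T -> {poly F}} *:%R (sum_y i) (sum_y_linear i).

Definition sum_rep : quiver_rep F n :=
  @QuiverRep F n (fun _ => {ffun T -> {poly F}}) sum_x sum_y.

Fact sum_xy (i : 'Z_n) (v : sum_rep (i - 1)) :
  xmap sum_rep (i - 1) (ymap sum_rep (i - 1) v) =
  ymap sum_rep i (xmap sum_rep i v).
Proof.
by apply/ffunP => t; rewrite !ffunE; apply: (rank1_xy (v t : rank1_rep F (A t) (i - 1))).
Qed.

Lemma sum_xpath m i (v : sum_rep (back m i)) t :
  (xpath sum_rep m i v : {ffun T -> {poly F}}) t = xpath (rank1_rep F (A t)) m i (v t).
Proof. by elim: m v => //= m IH v; rewrite IH ffunE. Qed.

Lemma sum_ypath m i (v : sum_rep i) t :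
  (ypath sum_rep m i v : {ffun T -> {poly F}}) t = ypath (rank1_rep F (A t)) m i (v t).
Proof. by elim: m => //= m IH; rewrite ffunE IH. Qed.

Fact sum_xk_yk (i : 'Z_n) (v : sum_rep (back k i)) :
  Tagged (Defs.space sum_rep) (xpath sum_rep k i v) =
  Tagged (Defs.space sum_rep) (ypath sum_rep (n - k) (back k i) v).
Proof.
have E t := @rank1_xk_yk F n k (A t) n_gt1 (cardA t) i (v t).
have Tagged_const j1 j2 (v1 v2 : {ffun T -> {poly F}}) : j1 = j2 -> v1 = v2 ->
    Tagged (Defs.space sum_rep) (v1 : sum_rep j1) = Tagged (Defs.space sum_rep) (v2 : sum_rep j2).
  by move=> -> ->.
apply: Tagged_const.
  by rewrite !backE -addrA -opprD -natrD subnKC ?Zn_natr_n ?subr0 // k_leqn.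
apply/ffunP => t; rewrite sum_xpath sum_ypath.
exact: (congr1 (fun s : {i & rank1_rep F (A t) i} => (tagged s : {poly F})) (E t)).
Qed.

Definition sum_bmod : bmod F n k := BMod sum_xy sum_xk_yk.

End DirectSum.

Section SumAction.
Variables (F : fieldType) (n k : nat).
Hypotheses (n_gt1 : (1 < n)%N) (k_leqn : (k <= n)%N).

Lemma rank1_act (I : {set 'Z_n}) (cI : #|I| = k) p i (v : rank1 F n_gt1 cI i) :
  bmod_act p v = p * v.
Proof.
rewrite /bmod_act; elim/poly_ind: p v => [|p c IH] v.
  by rewrite -polyC0 poly_actC scale0r mul0r.
rewrite poly_actDl poly_actMX poly_actC IH mulrDl mul_polyC /= /rank1_x /rank1_y.
by case: (_ \in I); rewrite mul1r mulrA.
Qed.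

Lemma rank1_homE (I : {set 'Z_n}) (cI : #|I| = k) M (f : bhom (rank1 F n_gt1 cI) M) i p :
  f i p = bmod_act p (f i 1).
Proof. by rewrite -bhom_act rank1_act mulr1. Qed.

Variables (T : finType) (A : T -> {set 'Z_n}).
Hypothesis cardA : forall t, #|A t| = k.
Local Notation Q := (sum_bmod F n_gt1 k_leqn cardA).

Lemma sum_act p i (v : Q i) : bmod_act p v = [ffun t => p * v t].
Proof.
rewrite /bmod_act; elim/poly_ind: p v => [|p c IH] v; apply/ffunP => t.
  by rewrite -polyC0 poly_actC scale0r !ffunE mul0r.
rewrite poly_actDl poly_actMX poly_actC IH !ffunE mulrDl mul_polyC /rank1_x /rank1_y.
by case: (_ \in A t); rewrite mul1r mulrA.
Qed.

Definition sum_unit t : {ffun T -> {poly F}} := [ffun s => (s == t)%:R].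

Lemma sum_homE M (f : bhom Q M) i v :
  f i v = \sum_t bmod_act (v t) (f i (sum_unit t)).
Proof.
have -> : f i v = f i (\sum_t bmod_act (v t) (sum_unit t : Q i)).
  congr (f i _); apply/ffunP => s; rewrite sum_ffunE (bigD1 s) //= big1 ?addr0.
    by rewrite sum_act !ffunE eqxx mulr1.
  by move=> t ts; rewrite sum_act !ffunE eq_sym (negbTE ts) mulr0.
rewrite (big_morph (f i) (@bhomD _ _ _ _ _ f i) (bhom0 f i)).
by apply: eq_bigr => t _; rewrite bhom_act.
Qed.
End SumAction.

(** * Indecomposable projectives *)

Section Projective.
Variables (F : fieldType) (n k : nat).
Hypotheses (n_gt1 : (1 < n)%N) (k_ltn : (k < n)%N).
Variables (T : finType) (c : T -> 'Z_n).

Definition proj_sum : bmod F n k :=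
  sum_bmod F n_gt1 (ltnW k_ltn) (fun t => card_proj_set n_gt1 k_ltn (c t)).

(** The basis element at each vertex is obtained from the one at c t by moving
    along x's inside (c t, c t + k] and along y's outside. *)
Lemma proj_sum_uniq M (f g : bhom proj_sum M) :
  (forall t, f (c t) (sum_unit F t) = g (c t) (sum_unit F t)) -> f = g.
Proof.
move=> fg; apply: bhomP => i v; rewrite (sum_homE f) (sum_homE g).
apply: eq_bigr => t _; congr bmod_act => {v}.
pose u : {ffun T -> {poly F}} := sum_unit F t.
pose P j := f j u = g j u.
have up j : j \in proj_set k (c t) -> P (j - 1) -> P j.
  move=> jK Pj; have uE : u = xmap proj_sum j u.
    apply/ffunP => s; rewrite !ffunE /rank1_x.
    by case: eqVneq => [->|_]; rewrite ?jK ?mulr1 ?mulr0.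
  by rewrite /P uE !bhom_x Pj.
have down j : j \notin proj_set k (c t) -> P j -> P (j - 1).
  move=> jK Pj; have uE : u = ymap proj_sum j u.
    apply/ffunP => s; rewrite !ffunE /rank1_y.
    by case: eqVneq => [->|_]; rewrite ?(negbTE jK) ?mulr1 ?mulr0.
  by rewrite /P uE !bhom_y Pj.
have Pc : P (c t) by apply: fg.
rewrite -/u -/(P i); move: P up down Pc => P up down Pc.
have memK := proj_set_prev n_gt1 k_ltn (c t).
have Pup d : (d <= k)%N -> P (c t + d%:R).
  elim: d => [|d IH] dk; first by rewrite addr0.
  have cd : c t + d.+1%:R - 1 = c t + d%:R by rewrite -natr1 addrA addrK.
  by apply: up; rewrite ?memK cd; [rewrite dist_addn | apply: IH]; lia.
have Pdown m : (m <= n - k)%N -> P (c t + (n - m)%:R).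
  elim: m => [|m IH] mk; first by rewrite subn0 Zn_natr_n // addr0.
  have cm : c t + (n - m.+1)%:R = c t + (n - m)%:R - 1.
    have -> : (n - m = (n - m.+1).+1)%N by lia.
    by rewrite -natr1 addrA addrK.
  rewrite cm; apply: down; last by apply: IH; lia.
  by rewrite memK -cm dist_addn; lia.
rewrite -(dist_add (c t) i); have := dist_ltn n_gt1 (c t) i.
move: (dist _ _) => d dn; have [/Pup //|kd] := leqP d k.
by rewrite -(subKn (ltnW dn)); apply: Pdown; lia.
Qed.

(** A map out of a sum of modules B e_c is the free choice of the images of the
    generators. *)
Lemma proj_sum_projective : projective proj_sum.
Proof.
move=> M N g f g_surj.
have lift t : exists m, g (c t) m = f (c t) (sum_unit F t) by apply: g_surj.
pose m t := sval (cid (lift t)).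
have mE t : g (c t) (m t) = f (c t) (sum_unit F t) by rewrite /m; case: cid.
pose p t := sval (cid (generator_orbit n_gt1 k_ltn (m t))).
have pE t : p t (c t) = m t by rewrite /p; case: cid => q [].
have px t i : xmap M i (p t (i - 1)) =
    bmod_act (if i \in proj_set k (c t) then 1 else 'X) (p t i).
  by rewrite /p; case: cid => q [].
have py t i : ymap M i (p t i) =
    bmod_act (if i \in proj_set k (c t) then 'X else 1) (p t (i - 1)).
  by rewrite /p; case: cid => q [].
pose h0 i (v : {ffun T -> {poly F}}) := \sum_t bmod_act (v t) (p t i).
have h_lin i : linear (h0 i : proj_sum i -> M i).
  move=> a u v; rewrite /h0 scaler_sumr -big_split; apply: eq_bigr => t _ /=.
  by rewrite !ffunE bmod_actDl bmod_actZ.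
have h_x i v : h0 i (xmap proj_sum i v) = xmap M i (h0 (i - 1) v).
  rewrite /h0 linear_sum; apply: eq_bigr => t _.
  by rewrite ffunE -bmod_act_x px -bmod_actM mulrC.
have h_y i v : h0 (i - 1) (ymap proj_sum i v) = ymap M i (h0 i v).
  rewrite /h0 linear_sum; apply: eq_bigr => t _.
  by rewrite ffunE -bmod_act_y py -bmod_actM mulrC.
exists (BHom h_lin h_x h_y); apply: proj_sum_uniq => t /=.
rewrite -mE -pE; congr (g _ _); rewrite /h0 (bigD1 t) //= big1.
  by rewrite ffunE eqxx bmod_act1 addr0.
by move=> s st; rewrite ffunE (negbTE st); apply: bmod_act0.
Qed.

End Projective.

(** * Homomorphisms given by powers of t *)

Lemma addn_sub_sub a b c : (a <= b)%N -> (b <= c)%N -> ((b - a) + (c - b) = c - a)%N.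
Proof. lia. Qed.

Section Monomial.
Variables (F : fieldType) (n k : nat).

(** Multiplication by t^(e i) at each vertex i is a homomorphism L_A -> L_B
    exactly when this holds. *)
Definition mono_exp (A B : {set 'Z_n}) (e : 'Z_n -> nat) :=
  forall i, (e i + (i \in B) = e (i - 1)%R + (i \in A))%N.

Lemma mono_x A B e i (p : {poly F}) : mono_exp A B e ->
  'X^(e i) * rank1_x A i p = rank1_x B i ('X^(e (i - 1)) * p).
Proof.
move=> /(_ i); rewrite /rank1_x !mulrA.
case: (i \in A); case: (i \in B); rewrite ?addn0 ?addn1 => eE.
- by case: eE => ->; ring.
- by rewrite eE exprS; ring.
- by rewrite -eE exprS; ring.
- by rewrite eE; ring.
Qed.

Lemma mono_y A B e i (p : {poly F}) : mono_exp A B e ->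
  'X^(e (i - 1)) * rank1_y A i p = rank1_y B i ('X^(e i) * p).
Proof.
move=> /(_ i); rewrite /rank1_y !mulrA.
case: (i \in A); case: (i \in B); rewrite ?addn0 ?addn1 => eE.
- by case: eE => ->; ring.
- by rewrite eE exprS; ring.
- by rewrite -eE exprS; ring.
- by rewrite eE; ring.
Qed.

Hypotheses (n_gt1 : (1 < n)%N) (k_leqn : (k <= n)%N).

Section Row.
Variables (T : finType) (A : T -> {set 'Z_n}) (B : {set 'Z_n}).
Hypotheses (cardA : forall t, #|A t| = k) (cardB : #|B| = k).
Variables (q : T -> {poly F}) (e : T -> 'Z_n -> nat).
Hypothesis e_mono : forall t, mono_exp (A t) B (e t).

Definition row_hom : bhom (sum_bmod F n_gt1 k_leqn cardA) (rank1 F n_gt1 cardB).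
Proof.
exists (fun i (v : {ffun T -> {poly F}}) => \sum_t q t * ('X^(e t i) * v t)).
- move=> i a u v; rewrite scaler_sumr -big_split; apply: eq_bigr => t _ /=.
  by rewrite !ffunE !mulrDr !scalerAr.
- move=> i v; rewrite linear_sum; apply: eq_bigr => t _ /=.
  by rewrite ffunE (mono_x _ _ (e_mono t)) /rank1_x mulrCA.
- move=> i v; rewrite linear_sum; apply: eq_bigr => t _ /=.
  by rewrite ffunE (mono_y _ _ (e_mono t)) /rank1_y mulrCA.
Defined.
End Row.

Section Column.
Variables (T : finType) (A : {set 'Z_n}) (B : T -> {set 'Z_n}).
Hypotheses (cardA : #|A| = k) (cardB : forall t, #|B t| = k).
Variables (e : T -> 'Z_n -> nat).
Hypothesis e_mono : forall t, mono_exp A (B t) (e t).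

Definition col_hom : bhom (rank1 F n_gt1 cardA) (sum_bmod F n_gt1 k_leqn cardB).
Proof.
exists (fun i (p : {poly F}) => [ffun t => 'X^(e t i) * p] : {ffun T -> {poly F}}).
- by move=> i a u v; apply/ffunP => t; rewrite !ffunE mulrDr scalerAr.
- by move=> i v; apply/ffunP => t; rewrite !ffunE (mono_x _ _ (e_mono t)).
- by move=> i v; apply/ffunP => t; rewrite !ffunE (mono_y _ _ (e_mono t)).
Defined.
End Column.
End Monomial.

(** * The presentation of a rank one module *)

Section Presentation.
Variables (F : fieldType) (n k : nat).
Hypotheses (n_gt1 : (1 < n)%N) (k_ltn : (k < n)%N).
Variables (I : {set 'Z_n}) (cI : #|I| = k).

(** L_I is generated by an element e_c for each vertex c, with one relation for
    each arrow: x e_(a-1) = e_a for a in I, and y e_a = e_(a-1) otherwise. This is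
    the vertex at which the relation of the arrow a lives. *)
Definition rel_vertex a : 'Z_n := if a \in I then a else a - 1.

Lemma wt_rel a i : (wt k I a i <= wt k I (rel_vertex a) i)%N.
Proof.
rewrite /rel_vertex; case: ifP => // aI; have := wt_source n_gt1 k_ltn a i cI.
by rewrite aI addn0 => <-; apply: leq_addr.
Qed.

Lemma wt_rel_prev a i : (wt k I (a - 1)%R i <= wt k I (rel_vertex a) i)%N.
Proof.
rewrite /rel_vertex; case: ifP => // aI; have := wt_source n_gt1 k_ltn a i cI.
rewrite aI addn1 => E; rewrite -ltnS -E; case: (_ < k)%N; lia.
Qed.

Lemma wt_rel_near a i : (dist a i < k)%N -> wt k I (rel_vertex a) i = wt k I (a - 1)%R i.
Proof.
rewrite /rel_vertex; case: ifP => // aI ai; have := wt_source n_gt1 k_ltn a i cI.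
by rewrite aI ai => /addIn.
Qed.

Lemma wt_rel_far a i : (k <= dist a i)%N -> wt k I (rel_vertex a) i = wt k I a i.
Proof.
rewrite /rel_vertex; case: ifP => // aI; rewrite leqNgt => /negbTE ai.
by have := wt_source n_gt1 k_ltn a i cI; rewrite aI ai !addn0.
Qed.

Local Notation Q0 := (proj_sum F n_gt1 k_ltn (fun c : 'Z_n => c)).
Local Notation Q1 := (proj_sum F n_gt1 k_ltn rel_vertex).

Lemma wt_mono c : mono_exp (proj_set k c) I (wt k I c).
Proof. by move=> i; apply: wt_vertex. Qed.

Definition aug : bhom Q0 (rank1 F n_gt1 cI) :=
  row_hom _ (ltnW k_ltn) (fun c => card_proj_set n_gt1 k_ltn c) cI (fun _ => 1) wt_mono.

Definition up_exp a i := (wt k I (rel_vertex a) i - wt k I (a - 1)%R i)%N.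
Definition down_exp a i := (wt k I (rel_vertex a) i - wt k I a i)%N.

Lemma wt_diff_mono (c d : 'Z_n) : (forall i, wt k I d i <= wt k I c i)%N ->
  mono_exp (proj_set k c) (proj_set k d) (fun i => wt k I c i - wt k I d i)%N.
Proof.
move=> dc i; have := dc i; have := dc (i - 1)%R.
have := wt_mono c i; have := wt_mono d i; lia.
Qed.

(** The component a of v is the coefficient of the relation of the arrow a, which
    involves e_(a-1) and e_a only. Taking all arrows, rather than the peaks and
    valleys of I only, gives a presentation that is not minimal but is uniform
    in a. *)
Definition diff0 i (v : {ffun 'Z_n -> {poly F}}) : {ffun 'Z_n -> {poly F}} :=
  [ffun c => 'X^(up_exp (c + 1) i) * v (c + 1) - 'X^(down_exp c i) * v c].

Definition diff : bhom Q1 Q0.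
Proof.
exists (fun i v => diff0 i v).
- move=> i a u v; apply/ffunP => c; rewrite !ffunE.
  by rewrite !mulrDr scalerBr !scalerAr opprD addrACA.
- move=> i v; apply/ffunP => c; rewrite !ffunE.
  have := mono_x i (v (c + 1)) (wt_diff_mono (wt_rel_prev (c + 1))).
  have := mono_x i (v c) (wt_diff_mono (wt_rel c)).
  by rewrite /up_exp /down_exp addrK => -> ->; rewrite /rank1_x mulrBr.
- move=> i v; apply/ffunP => c; rewrite !ffunE.
  have := mono_y i (v (c + 1)) (wt_diff_mono (wt_rel_prev (c + 1))).
  have := mono_y i (v c) (wt_diff_mono (wt_rel c)).
  by rewrite /up_exp /down_exp addrK => -> ->; rewrite /rank1_y mulrBr.
Defined.

(** The second syzygy of L_I is the rank one module of I + k. *)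
Definition shift_set : {set 'Z_n} := [set i | i - k%:R \in I].

Lemma in_shift_set (i : 'Z_n) : (i \in shift_set) = (i - k%:R \in I).
Proof. by rewrite inE. Qed.

Lemma card_shift_set : #|shift_set| = k.
Proof.
rewrite -[RHS]cI -(card_imset I (addIr k%:R)); apply: eq_card => i; rewrite inE.
apply/idP/imsetP => [iI|[j jI ->]]; last by rewrite addrK.
by exists (i - k%:R); rewrite ?subrK.
Qed.

Lemma syz2_mono a : mono_exp shift_set (proj_set k (rel_vertex a))
  (fun i => wt_max k I i - wt k I (rel_vertex a) i)%N.
Proof.
move=> i; have := wt_le_max n_gt1 k_ltn (rel_vertex a) i cI.
have := wt_le_max n_gt1 k_ltn (rel_vertex a) (i - 1) cI.
have := wt_mono (rel_vertex a) i; have := wt_max_vertex n_gt1 k_ltn i cI.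
rewrite in_shift_set; move: (wt_max k I i) (wt_max k I (i - 1)%R).
move: (wt k I (rel_vertex a) i) (wt k I (rel_vertex a) (i - 1)%R).
move: (_ \in proj_set _ _) (i - k%:R \in I) (i \in I); lia.
Qed.

Definition syz2 : bhom (rank1 F n_gt1 card_shift_set) Q1 :=
  col_hom F _ (ltnW k_ltn) card_shift_set
    (fun a => card_proj_set n_gt1 k_ltn (rel_vertex a)) syz2_mono.

Lemma syz2_inj i v : syz2 i v = 0 -> v = 0.
Proof.
move/ffunP/(_ 0); rewrite !ffunE => /eqP.
by rewrite mulf_eq0 expf_eq0 polyX_eq0 andbF => /eqP.
Qed.

Lemma aug_surj : surjective aug.
Proof.
move=> i w; exists [ffun c => if c == i then w : {poly F} else 0] => /=.
rewrite (bigD1 i) //= big1 => [|c ci]; rewrite ffunE.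
  by rewrite eqxx wt_id // !mul1r addr0.
by rewrite (negbTE ci) !mulr0.
Qed.

Lemma diff_aug i v : aug i (diff i v) = 0.
Proof.
rewrite /=; under eq_bigr do rewrite mul1r ffunE mulrBr !mulrA -!exprD.
rewrite sumrB (reindex_inj (addIr (-1))) /=.
apply/eqP; rewrite subr_eq0; apply/eqP.
apply: eq_bigr => a _; rewrite subrK.
by rewrite subnKC ?wt_rel_prev // subnKC ?wt_rel.
Qed.

Lemma syz2_diff i p : diff i (syz2 i p) = 0.
Proof.
apply/ffunP => c; rewrite !ffunE !mulrA -!exprD.
rewrite /up_exp /down_exp addn_sub_sub ?wt_rel_prev ?wt_le_max //.
by rewrite addn_sub_sub ?wt_rel ?wt_le_max // addrK subrr.
Qed.

(** The kernel condition at c relates the components at c and c + 1, so that a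
    vector of the kernel is determined by one component; the component at i - k
    carries exponent 0, since wt is maximal there. *)
Lemma exact_syz2 : exact_at syz2 diff.
Proof.
move=> i v; split=> [dv|[p <-]]; last exact: syz2_diff.
pose s a := (wt_max k I i - wt k I (rel_vertex a) i)%N.
pose a0 := i - k%:R.
have s0 : s a0 = 0%N.
  by apply/eqP; rewrite subn_eq0; apply: (leq_trans _ (wt_rel a0 i)).
exists ((v : {ffun 'Z_n -> {poly F}}) a0).
suff H m : (v : {ffun 'Z_n -> {poly F}}) (a0 + m%:R) = 'X^(s (a0 + m%:R)) * v a0.
  by apply/ffunP => c; rewrite ffunE -(dist_add a0 c) H.
elim: m => [|m IH]; first by rewrite addr0 s0 mul1r.
set c := a0 + m%:R in IH *; rewrite -natr1 addrA -/c.
move/ffunP/(_ c): dv; rewrite !ffunE => /subr0_eq; rewrite IH mulrA -exprD => E.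
apply: (mulfI (x := 'X^(up_exp (c + 1) i))).
  by rewrite expf_eq0 polyX_eq0 andbF.
have up_le := wt_rel_prev (c + 1) i; rewrite addrK in up_le.
have down_le := wt_rel c i; have le_max a := wt_le_max n_gt1 k_ltn a i cI.
by rewrite E mulrA -exprD /s /up_exp /down_exp addrK !addn_sub_sub ?le_max.
Qed.

Local Notation act p v := [ffun s => p * (v : {ffun 'Z_n -> {poly F}}) s].

Lemma diff0_unit i a : diff0 i (sum_unit F a) =
  act 'X^(up_exp a i) (sum_unit F (a - 1)) - act 'X^(down_exp a i) (sum_unit F a).
Proof.
apply/ffunP => c; rewrite !ffunE.
have -> : (c + 1 == a) = (c == a - 1) by rewrite [RHS]eq_sym subr_eq eq_sym.
congr (_ - _); first by case: eqVneq => [->|]; rewrite ?subrK ?mulr0.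
by case: eqVneq => [->|]; rewrite ?mulr0.
Qed.

(** Modulo the relations, every generator e_c becomes a power of t times e_i at
    the vertex i: go from i backward for k steps and forward for n - k steps, in
    the direction in which the relation expresses the next generator by the
    previous one. A combination of generators is then congruent to its image
    times e_i. *)
Lemma exact_aug : exact_at diff aug.
Proof.
move=> i w; split=> [augw|[v <-]]; last exact: diff_aug.
pose Im u := exists v, diff0 i v = u.
have Im0 : Im 0 by exists 0; apply: (bhom0 diff).
have ImD p u v : Im u -> Im v -> Im (act p u + v).
  move=> [u' <-] [v' <-]; exists (act p u' + v').
  have := bhom_act diff p (u' : Q1 i); rewrite !sum_act => <-.
  exact: (bhomD diff).
pose cong c := Im (sum_unit F c - act 'X^(wt k I c i) (sum_unit F i)).
have ImU a : Im (diff0 i (sum_unit F a)) by exists (sum_unit F a).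
have near a : (dist a i < k)%N -> cong a -> cong (a - 1).
  move=> ai ca; have := wt_rel a i; have := wt_rel_near ai.
  move=> rel_near le_rel; have := ImD 'X^(down_exp a i) _ _ ca (ImU a).
  congr Im; rewrite diff0_unit /up_exp /down_exp rel_near subnn.
  rewrite -rel_near -[X in _ = _ - [ffun s => 'X^X * _]](subnK le_rel) exprD.
  by apply/ffunP => s; rewrite !ffunE; ring.
have far a : (k <= dist a i)%N -> cong (a - 1) -> cong a.
  move=> ai ca; have := wt_rel_prev a i; have := wt_rel_far ai.
  move=> rel_far le_rel; have := ImD (-1) _ _ (ImU a) (ImD 'X^(up_exp a i) _ _ ca Im0).
  congr Im; rewrite diff0_unit /up_exp /down_exp rel_far subnn.
  rewrite -rel_far -[X in _ = _ - [ffun s => 'X^X * _]](subnK le_rel) exprD.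
  by apply/ffunP => s; rewrite !ffunE; ring.
have cong_i : cong i.
  by move: Im0; congr Im; apply/ffunP => s; rewrite !ffunE wt_id // mul1r subrr.
have cong_near d : (d <= k)%N -> cong (i - d%:R).
  elim: d => [|d IH] dk; first by rewrite subr0.
  have -> : i - d.+1%:R = i - d%:R - 1 by rewrite -natr1 opprD addrA.
  apply: near; last by apply: IH; lia.
  by rewrite -[X in dist _ X](subrK d%:R i) dist_addn //; lia.
have cong_far m : (m <= n - k)%N -> cong (i + m%:R).
  elim: m => [|m IH] mk; first by rewrite addr0.
  apply: far; last by rewrite -natr1 addrA addrK; apply: IH; lia.
  have -> : dist (i + m.+1%:R) i = (n - m.+1)%N; last by lia.
  have iE : i + m.+1%:R + (n - m.+1)%:R = i.
    by rewrite -addrA -natrD subnKC ?Zn_natr_n ?addr0 //; lia.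
  by rewrite -[X in dist _ X]iE dist_addn //; lia.
have cong_all c : cong c.
  have -> : c = i - (dist c i)%:R by rewrite -{1}(dist_add c i) addrK.
  have [/cong_near //|kd] := leqP (dist c i) k.
  have := dist_ltn n_gt1 c i; move: (dist c i) kd => d kd dn.
  have -> : - d%:R = (n - d)%:R :> 'Z_n by rewrite natrB ?Zn_natr_n ?sub0r // ltnW.
  by apply: cong_far; lia.
(* The correction terms add up to the image of w, which is zero, times e_i. *)
have -> : w = \sum_c act (w c) (sum_unit F c - act 'X^(wt k I c i) (sum_unit F i)) :> {ffun _}.
  apply/ffunP => s; rewrite sum_ffunE.
  under eq_bigr do rewrite !ffunE mulrBr.
  rewrite sumrB (bigD1 s) //= eqxx mulr1 big1 ?addr0 => [|c cs]; last first.
    by rewrite eq_sym (negbTE cs) mulr0.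
  under eq_bigr do rewrite mulrA [w _ * _]mulrC.
  rewrite -mulr_suml; move: augw => /=.
  by under eq_bigr do rewrite mul1r; move->; rewrite mul0r subr0.
by elim/big_rec: _ => // c u _; apply: ImD; apply: cong_all.
Qed.
End Presentation.

Section MonomialHom.
Variables (F : fieldType) (n k : nat) (n_gt1 : (1 < n)%N).
Variables (A B : {set 'Z_n}) (cA : #|A| = k) (cB : #|B| = k) (e : 'Z_n -> nat).
Hypothesis e_mono : mono_exp A B e.

Definition mono_hom : bhom (rank1 F n_gt1 cA) (rank1 F n_gt1 cB).
Proof.
exists (fun i (p : {poly F}) => 'X^(e i) * p : {poly F}).
- by move=> i a u v; rewrite mulrDr scalerAr.
- by move=> i v; rewrite /= (mono_x _ _ e_mono).
- by move=> i v; rewrite /= (mono_y _ _ e_mono).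
Defined.

(** A homomorphism of rank one modules commutes with t, so it is determined by a
    polynomial at each vertex, and these propagate along the arrows. Where the
    exponent is 0 the polynomial is the coefficient. *)
Lemma mono_hom_gen i0 (f : bhom (rank1 F n_gt1 cA) (rank1 F n_gt1 cB)) :
  e i0 = 0%N -> f = (f i0 1 : {poly F}) *: mono_hom.
Proof.
move=> e0; pose g i : {poly F} := f i 1.
suff gE i : g i = g i0 * 'X^(e i).
  apply: bhomP => i v; rewrite (rank1_homE f) rank1_act -/(g i) gE.
  rewrite [RHS](rank1_act (n_gt1 := n_gt1)) /=.
  exact: etrans (mulrC _ _) (esym (mulrA _ _ _)).
rewrite -(dist_add i0 i); elim: (dist i0 i) => [|m]; first by rewrite addr0 e0 mulr1.
set j := i0 + m.+1%:R; have -> : i0 + m%:R = j - 1 by rewrite /j -natr1 addrA addrK.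
move=> IH; have := bhom_x f (i := j) 1.
rewrite (rank1_homE f) rank1_act -/(g j) -/(g (j - 1)) IH /= /rank1_x.
have := e_mono j; case: (j \in A); case: (j \in B); rewrite ?addn0 ?addn1 ?mulr1 ?mul1r.
- by move=> [<-].
- by move=> -> ->; rewrite exprS; ring.
- move=> <-; rewrite exprS => E; apply: (mulfI (x := 'X)); first by rewrite polyX_eq0.
  by rewrite E; ring.
- move=> -> E; apply: (mulfI (x := 'X)); first by rewrite polyX_eq0.
  by rewrite E; ring.
Qed.
End MonomialHom.

(** * The second extension group *)

Section SecondExt.
Variables (F : fieldType) (n k : nat).
Hypotheses (n_gt1 : (1 < n)%N) (k_ltn : (k < n)%N).
Variables (I J : {set 'Z_n}) (cI : #|I| = k) (cJ : #|J| = k).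

Local Notation L := (rank1 F n_gt1 (card_shift_set cI)).
Local Notation N := (rank1 F n_gt1 cJ).
Local Notation syz2 := (syz2 F n_gt1 k_ltn cI).

Lemma ext_wt_mono c : mono_exp (shift_set k I) J (ext_wt k I J c).
Proof. by move=> i; rewrite in_shift_set; apply: ext_wt_vertex. Qed.

Variables (a : nat) (v0 : 'Z_n) (i0 : 'Z_n).
Hypotheses (v0I : v0 \in I) (a_att : a = ext_wt k I J v0 i0).
Hypothesis a_le : forall c i, (a <= ext_wt k I J c i)%N.

(** All the functions ext_wt I J c of the vertex differ by constants. The one that
    attains the minimum a, lowered by a, is the exponent of a generator of
    Hom(L_(I+k), L_J). *)
Definition gen_exp i := (ext_wt k I J v0 i - a)%N.

Lemma gen_exp_mono : mono_exp (shift_set k I) J gen_exp.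
Proof.
move=> i; have := ext_wt_mono v0 i; have := a_le v0 i; have := a_le v0 (i - 1).
rewrite /gen_exp; move: (_ \in J) (_ \in shift_set _ _).
by move: (ext_wt k I J v0 i) (ext_wt k I J v0 (i - 1)%R); lia.
Qed.

Definition gen : bhom L N := mono_hom F n_gt1 (card_shift_set cI) cJ gen_exp_mono.

Lemma wt_syz2 c i : (wt k J c i + (wt_max k I i - wt k I c i) = ext_wt k I J c i)%N.
Proof. by rewrite addnC. Qed.

Definition weight_row (T : finType) (c : T -> 'Z_n) (q : T -> {poly F}) :
    bhom (proj_sum F n_gt1 k_ltn c) N :=
  row_hom n_gt1 (ltnW k_ltn) (fun t => card_proj_set n_gt1 k_ltn (c t)) cJ q
    (fun t => wt_mono n_gt1 k_ltn cJ (c t)).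

Lemma proj_sum_hom (T : finType) (c : T -> 'Z_n) (g : bhom (proj_sum F n_gt1 k_ltn c) N) :
  g = weight_row c (fun t => g (c t) (sum_unit F t) : {poly F}).
Proof.
apply: proj_sum_uniq => t /=; rewrite (bigD1 t) //= big1 => [|s st].
  by rewrite ffunE eqxx wt_id // !mulr1 addr0.
by rewrite ffunE (negbTE st) !mulr0.
Qed.

Lemma weight_row_syz2 q i (v : {poly F}) :
  weight_row (rel_vertex I) q i (syz2 i v) =
    \sum_t q t * ('X^(ext_wt k I J (rel_vertex I t) i) * v).
Proof.
by apply: eq_bigr => t _; rewrite ffunE [_ * (_ * v)]mulrA -exprD wt_syz2.
Qed.

(** A map from the sum of projectives to L_J has one coefficient for each arrow,
    so the maps that extend are the combinations of the powers t^(ext_wt c i);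
    at the vertex i0 the coefficient p is such a combination, hence divisible by
    t^a. Conversely the minimum is attained at the single component v0. *)
Lemma gen_extends (p : {poly F}) :
  (exists g, p *: gen = bhom_comp g syz2) <-> 'X^a %| p.
Proof.
split=> [[g gE]|/dvdpP[r ->]].
  have := congr1 (fun h : bhom L N => h i0 (1 : {poly F})) gE.
  rewrite [LHS](rank1_act (n_gt1 := n_gt1)) /= /gen_exp -a_att subnn mulr1 mulr1.
  move=> ->; rewrite [g]proj_sum_hom -[X in _ %| X]/(weight_row _ _ i0 (syz2 i0 1)).
  rewrite weight_row_syz2; apply: (big_ind (fun q : {poly F} => 'X^a %| q)) => [|p1 p2|t _].
  - exact: dvdp0.
  - exact: dvdp_add.
  by rewrite mulr1 dvdp_mull // dvdp_exp2l.
exists (weight_row (rel_vertex I) (fun t => if t == v0 then r else 0)).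
apply: bhomP => i v; rewrite [LHS](rank1_act (n_gt1 := n_gt1)) [RHS]weight_row_syz2.
rewrite (bigD1 v0) //= big1 => [|t tv]; last by rewrite (negbTE tv) mul0r.
rewrite eqxx /rel_vertex v0I addr0 [X in X = _]mulrA -[r * _ * _]mulrA -exprD.
by rewrite /gen_exp subnKC // -mulrA.
Qed.

Lemma gen_spans (f : bhom L N) : exists p : {poly F}, f = p *: gen.
Proof.
exists (f i0 1); apply: mono_hom_gen.
by rewrite /gen_exp -a_att subnn.
Qed.

Variable P : projective_resolution (rank1 F n_gt1 cI).

(** The ring F[t] maps onto Hom(L_(I+k), L_J) by p |-> p gen, and the maps that
    extend to the projective correspond to the multiples of t^a. *)
Lemma Ext2_iso : lmod_isomorphic (Ext P N 2%N) (truncated_poly F a).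
Proof.
have [phi [phi_cocycle phi_cobound phi_onto]] :=
  comparison N P (@proj_sum_projective F n k n_gt1 k_ltn _ (rel_vertex I))
    (@proj_sum_projective F n k n_gt1 k_ltn _ (fun c : 'Z_n => c))
    (@syz2_inj F n k n_gt1 k_ltn I cI)
    (@exact_syz2 F n k n_gt1 k_ltn I cI) (@exact_aug F n k n_gt1 k_ltn I cI)
    (@aug_surj F n k n_gt1 k_ltn I cI).
pose Phi (p : ({poly F})^o) := Cocycle (phi_cocycle (p *: gen)).
have Phi_lin : linear Phi.
  move=> c p q; apply: val_inj; apply: bhomP => i v /=.
  by rewrite bmod_actDl; congr (_ + _); apply: (@bmod_actM _ _ _ N c p i).
pose PhiL : {linear ({poly F})^o -> cocycles P N 2} :=
  HB.pack Phi (GRing.isLinear.Build {poly F} _ _ _ Phi Phi_lin).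
apply: (@quot_lmod_iso _ _ _ (@Xn_ideal F a) (@coboundary _ _ _ _ P N 2%N) PhiL) => [p|w].
  split=> [/asboolP/phi_cobound/gen_extends //|pa].
  by apply/asboolP/phi_cobound/gen_extends.
have [f fw] := phi_onto (val w) (valP w); have [p fE] := gen_spans f.
by exists p; apply/asboolP; rewrite linearB /= -fE.
Qed.

End SecondExt.

Local Close Scope ring_scope.

Theorem corollary3p9 (F : closedFieldType) (n k : nat)
    (n_ge2 : (2 <= n)%N) (k_bounds : (1 <= k <= n - 1)%N)
    (I J : {set 'Z_n}) (cardI : #|I| = k) (cardJ : #|J| = k)
    (P : projective_resolution (rank1 F n_ge2 cardI)) (a : nat) :
  lmod_isomorphic (Ext P (rank1 F n_ge2 cardJ) 2) (truncated_poly F a) <->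
  is_min2 (starts I) (ends I) (auv k I J) a.
Proof.
have k_gt0 : (0 < k)%N by case/andP: k_bounds.
have k_ltn : (k < n)%N by lia.
have min_iso b : is_min2 (starts I) (ends I) (auv k I J) b ->
    lmod_isomorphic (Ext P (rank1 F n_ge2 cardJ) 2) (truncated_poly F b).
  move=> /(min_auvP n_ge2 k_ltn k_gt0 cardI cardJ)[[v [i [vI bE]]] b_le].
  have vI0 : v \in I by move: vI; rewrite inE => /andP[].
  exact: (Ext2_iso k_ltn cardJ vI0 bE b_le P).
split=> [iso_a|]; last exact: min_iso.
have [b b_min] := min_auv_exists n_ge2 k_ltn k_gt0 cardI cardJ.
suff -> : a = b by [].
have iso_b := min_iso b b_min.
by apply/eqP; rewrite eqn_leq !(truncated_poly_le iso_a, truncated_poly_le iso_b).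
Qed.
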